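(* Let $N\ge3$, $s\in(0,2)$, $\lambda,\mu>0$, $\kappa>0$, $\alpha>1$, $\beta>1$, $\alpha+\beta=2^*(s)$, and let $\Omega\subset\mathbb{R}^N$ be an open bounded domain. If $0\in\Omega$, then $S_{\alpha,\beta,\lambda,\mu}(\Omega)$ is not attained.
   Context: $2^*(s):=\frac{2(N-s)}{N-2}$. $D_0^{1,2}(\Omega)$ is the completion of $C_c^\infty(\Omega)$ in the norm $(\int_\Omega|\nabla u|^2dx)^{1/2}$. $$S_{\alpha,\beta,\lambda,\mu}(\Omega):=\inf\frac{\int_\Omega(|\nabla u|^2+|\nabla v|^2)dx}{\Big(\int_\Omega\big(\lambda\frac{|u|^{2^*(s)}}{|x|^s}+\mu\frac{|v|^{2^*(s)}}{|x|^s}+2^*(s)\kappa\frac{|u|^\alpha|v|^\beta}{|x|^s}\big)dx\Big)^{2/2^*(s)}},$$ the infimum being over $(u,v)\in D_0^{1,2}(\Omega)\times D_0^{1,2}(\Omega)$, $(u,v)\ne(0,0)$; ''not attained'' means no such pair realizes the infimum. *)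

(* Defs.v *)
From HB Require Import structures.
From mathcomp Require Import all_boot all_order all_algebra.
From mathcomp Require Import all_classical all_reals all_analysis.
Set Implicit Arguments.
Unset Strict Implicit.
Unset Printing Implicit Defensive.
Import Order.TTheory GRing.Theory Num.Theory.
Import numFieldNormedType.Exports.
Local Open Scope classical_set_scope.
Local Open Scope ring_scope.

(* 'rV[R]_n carries the product of the Borel sigma-algebras of R, i.e. the
   Borel sigma-algebra of R^n. *)
Definition rV_display : measure_display.
Proof. exact: default_measure_display. Qed.

Section measurable_rV.
Context {R : realType} {n : nat}.

Let coors : 'I_n -> 'rV[R]_n -> measurableTypeR R := fun i x => x 0 i.

Let rV_set0 : g_sigma_preimage coors set0.
Proof. exact: sigma_algebra0. Qed.

Let rV_setC A : g_sigma_preimage coors A -> g_sigma_preimage coors (~` A).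
Proof. exact: sigma_algebraC. Qed.

Let rV_bigcup (F : _^nat) : (forall i, g_sigma_preimage coors (F i)) ->
  g_sigma_preimage coors (\bigcup_i (F i)).
Proof. exact: sigma_algebra_bigcup. Qed.

HB.instance Definition _ := @isMeasurable.Build rV_display
  'rV[R]_n (g_sigma_preimage coors) rV_set0 rV_setC rV_bigcup.

Lemma measurable_coord (i : 'I_n) :
  measurable_fun [set: 'rV[R]_n] (fun x : 'rV[R]_n => x 0 i : measurableTypeR R).
Proof.
move=> _ Y mY; rewrite setTI; apply: sub_sigma_algebra => /=.
rewrite -bigcup_seq/=; exists i => /=; first by rewrite mem_index_enum.
by exists Y => //; rewrite setTI.
Qed.

Lemma measurable_fun_rV d (T : measurableType d) (f : T -> 'rV[R]_n) :
  (forall i, measurable_fun [set: T] (fun x => f x 0 i : measurableTypeR R)) ->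
  measurable_fun [set: T] f.
Proof.
move=> mf _ A mA.
suff : g_sigma_preimage coors `<=` image_set_system setT f measurable by apply.
apply: smallest_sub; first exact/sigma_algebra_image/sigma_algebra_measurable.
move=> B; rewrite -bigcup_seq/= => -[i _ [C mC <-]].
rewrite /image_set_system/= setTI.
by have := mf i measurableT C mC; rewrite !setTI.
Qed.

End measurable_rV.

Section lebesgue_rV.
Context {R : realType}.

Definition rV_cons n (p : measurableTypeR R * 'rV[R]_n) : 'rV[R]_n.+1 :=
  row_mx (p.1 : R)%:M p.2.

Definition rV_uncons n (x : 'rV[R]_n.+1) : measurableTypeR R * 'rV[R]_n :=
  (x 0 0, \row_i x 0 (lift 0 i)).

Lemma rV_cons0 n p : @rV_cons n p 0 0 = p.1.
Proof. by rewrite /rV_cons mxE; case: splitP => // j; rewrite ord1 mxE eqxx. Qed.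

Lemma rV_consS n p i : @rV_cons n p 0 (lift 0 i) = p.2 0 i.
Proof.
rewrite /rV_cons mxE; case: splitP => [j|j] /=; first by rewrite ord1.
by move=> [] /val_inj ->.
Qed.

Lemma rV_consK n : cancel (@rV_cons n) (@rV_uncons n).
Proof.
move=> [a v]; rewrite /rV_uncons rV_cons0; congr pair.
by apply/rowP => i; rewrite mxE rV_consS.
Qed.

Lemma measurable_rV_cons n : measurable_fun setT (@rV_cons n).
Proof.
apply: measurable_fun_rV => i; have [j ->|->] := unliftP 0 i.
  rewrite (_ : (fun _ => _) =
      (fun x : 'rV[R]_n => x 0 j : measurableTypeR R) \o snd).
    exact: measurableT_comp (measurable_coord j) measurable_snd.
  by apply/funext => p /=; rewrite rV_consS.
rewrite (_ : (fun _ => _) = fst) //.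
by apply/funext => p /=; rewrite rV_cons0.
Qed.

Lemma measurable_rV_uncons n : measurable_fun setT (@rV_uncons n).
Proof.
apply/measurable_fun_pairP; split; first exact: measurable_coord.
apply: measurable_fun_rV => i /=.
under eq_fun do rewrite mxE.
exact: measurable_coord.
Qed.

Section step.
Context {n : nat} (m : {sigma_finite_measure set 'rV[R]_n -> \bar R}).

Definition lebesgue_rV_step : set 'rV[R]_n.+1 -> \bar R :=
  pushforward (@lebesgue_measure R \x m)%E (@rV_cons n).

Let step0 : lebesgue_rV_step set0 = 0%E.
Proof. by rewrite /lebesgue_rV_step /pushforward preimage_set0 measure0. Qed.

Let step_ge0 A : (0 <= lebesgue_rV_step A)%E.
Proof. by rewrite /lebesgue_rV_step /pushforward measure_ge0. Qed.

Let step_sigma_additive : semi_sigma_additive lebesgue_rV_step.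
Proof.
have mpre A : measurable A -> measurable (@rV_cons n @^-1` A).
  by move=> mA; rewrite -[X in measurable X]setTI; exact: measurable_rV_cons.
move=> F mF tF mUF; rewrite /lebesgue_rV_step /pushforward preimage_bigcup.
apply: measure_semi_sigma_additive.
- by move=> k; exact: mpre.
- apply/trivIsetP => /= i j _ _ ij; rewrite -preimage_setI.
  by move/trivIsetP : tF => /(_ _ _ _ _ ij) ->//; rewrite preimage_set0.
- by rewrite -preimage_bigcup; exact: mpre.
Qed.

HB.instance Definition _ := isMeasure.Build _ _ _ lebesgue_rV_step
  step0 step_ge0 step_sigma_additive.

Let step_sigma_finite : sigma_finite setT lebesgue_rV_step.
Proof.
have /sigma_finiteP[F [TF ndF Foo]] := sigma_finiteT (@lebesgue_measure R).
have /sigma_finiteP[G [TG ndG Goo]] := sigma_finiteT m.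
exists (fun k => @rV_uncons n @^-1` (F k `*` G k)).
  apply/esym; rewrite -subTset => x _.
  have [k _ Fk] : (\bigcup_k F k) (rV_uncons x).1 by rewrite -TF.
  have [l _ Gl] : (\bigcup_k G k) (rV_uncons x).2 by rewrite -TG.
  exists (maxn k l) => //; split.
    by move: Fk; exact/subsetPset/ndF/leq_maxl.
  by move: Gl; exact/subsetPset/ndG/leq_maxr.
move=> k; have [mF Fk] := Foo k; have [mG Gk] := Goo k; split.
  rewrite -[X in measurable X]setTI; apply: measurable_rV_uncons => //.
  exact: measurableX.
rewrite /lebesgue_rV_step /pushforward -comp_preimage.
rewrite (_ : _ \o _ = id); last by apply/funext => p /=; rewrite rV_consK.
by rewrite preimage_id product_measure1E// lte_mul_pinfty// ge0_fin_numE.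
Qed.

HB.instance Definition _ := Measure_isSigmaFinite.Build _ _ _ lebesgue_rV_step
  step_sigma_finite.

End step.

(* The N-fold product of the Lebesgue measure of R, transported to 'rV[R]_N *)
Fixpoint lebesgue_rV n : {sigma_finite_measure set 'rV[R]_n -> \bar R} :=
  if n is n'.+1 then lebesgue_rV_step (lebesgue_rV n') else \d_(0 : 'rV[R]_0).

End lebesgue_rV.

Section calculus.
Context {R : realType} {N : nat}.
Implicit Types (x : 'rV[R]_N) (f u : 'rV[R]_N -> R) (Omega : set 'rV[R]_N).

(* The library norm `|x| of a row vector is the sup norm. *)
Definition enorm x : R := Num.sqrt (\sum_i x 0 i ^+ 2).

Definition partial (i : 'I_N) f : 'rV[R]_N -> R := 'D_(delta_mx 0 i) f.

Definition grad f x : 'rV[R]_N := \row_i partial i f x.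

Definition smooth f : Prop := forall (s : seq 'I_N) (g := foldr partial f s),
  continuous g /\ forall i x, derivable g x (delta_mx 0 i).

(* C_c^oo(Omega), its elements being extended by 0 to the whole space *)
Definition Cc_smooth Omega f : Prop :=
  [/\ smooth f, compact (closure [set x | f x != 0])
    & closure [set x | f x != 0] `<=` Omega].

Definition ae_zero Omega u : Prop :=
  {ae @lebesgue_rV R N, forall x, Omega x -> u x = 0}.

(* The exponent 2^*(s) *)
Definition twostar (s : R) : R := 2 * (N%:R - s) / (N%:R - 2).

End calculus.
Arguments twostar {R} N s.

Notation Leb := (@lebesgue_rV _ _) (only parsing).

(* For N >= 3 the Sobolev inequality realizes the completion of C_c^oo(Omega)
   in the norm |grad f|_{L^2} as a space of functions of L^{2^*}, 2^* = 2^*(0):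
   an element is a limit D12_fun in L^{2^*} of test functions whose gradients
   converge in L^2, and its gradient D12_grad is the limit of these gradients.
   As in any L^p space, D12_fun and D12_grad are relevant only up to equality
   almost everywhere on Omega. *)
Record D12_0 (R : realType) (N : nat) (Omega : set 'rV[R]_N) := {
  D12_fun :> 'rV[R]_N -> R ;
  D12_grad : 'rV[R]_N -> 'rV[R]_N ;
  D12_measurable_fun :
    measurable_fun Omega (D12_fun : 'rV[R]_N -> measurableTypeR R) ;
  D12_measurable_grad : measurable_fun Omega D12_grad ;
  D12_approx : exists phi : nat -> 'rV[R]_N -> R,
    [/\ forall n, Cc_smooth Omega (phi n),
        (\int[Leb]_(x in Omega)
           (`|phi n x - D12_fun x| `^ twostar N 0)%:E)%E @[n --> \oo] --> 0%E
      & (\int[Leb]_(x in Omega)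
           (enorm (grad (phi n) x - D12_grad x) ^+ 2)%:E)%E @[n --> \oo]
          --> 0%E] }.

Section quotient.
Context {R : realType} {N : nat} (Omega : set 'rV[R]_N)
  (s lambda mu kappa alpha beta : R).
Implicit Types u v : D12_0 Omega.

(* The integrands are integrable (by definition of D12_0 for the energy, by the
   Hardy-Sobolev inequality for the coupling), so that the real-valued integral
   is meant literally. At x = 0 the weight enorm x `^ s in the denominator
   takes a junk value, on a null set. *)
Definition energy u v : R :=
  \int[Leb]_(x in Omega)
    (enorm (D12_grad u x) ^+ 2 + enorm (D12_grad v x) ^+ 2).

Definition coupling u v : R :=
  \int[Leb]_(x in Omega)
    (lambda * (`|u x| `^ twostar N s / enorm x `^ s)
     + mu * (`|v x| `^ twostar N s / enorm x `^ s)
     + twostar N s * kappa * (`|u x| `^ alpha * `|v x| `^ beta / enorm x `^ s)).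

Definition quotient u v : R :=
  energy u v / coupling u v `^ (2 / twostar N s).

Definition nonzero_pair u v : Prop := ~ (ae_zero Omega u /\ ae_zero Omega v).

(* The set is nonempty when Omega is, and bounded below by 0, so inf is a
   genuine infimum. *)
Definition S_inf : R :=
  inf [set q | exists u v, nonzero_pair u v /\ q = quotient u v].

Definition S_attained : Prop :=
  exists u v, nonzero_pair u v /\ quotient u v = S_inf.

End quotient.

(* Main.v *)
Require Import Defs.
From mathcomp Require Import all_boot all_order all_algebra.
From mathcomp Require Import all_classical all_reals all_analysis.
From mathcomp Require Import measurable_realfun ring lra.
Import Order.TTheory GRing.Theory Num.Theory.
Import numFieldNormedType.Exports.
Set Implicit Arguments.
Unset Strict Implicit.
Unset Printing Implicit Defensive.
Local Open Scope classical_set_scope.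
Local Open Scope ring_scope.

(** The quotient is invariant under the dilations x |-> x / tau, so a minimizer
    (u, v) on the bounded set Omega may be shrunk until it lives well inside
    Omega, and there is room around it for a cutoff eta, a test function of
    Omega that is a positive constant on a neighbourhood of the shrunk support.
    Compare (u, v) with (|u| + t eta, |v| + t eta) for a small t > 0. Since
    grad eta vanishes wherever u and v live, the energy has no cross term and
    grows only by O(t^2). The coupling, on the other hand, grows at least
    linearly in t, because both components are nonnegative and are raised by a
    positive constant on their supports. As the energy of a minimizer is
    positive, the quotient decreases for small t, a contradiction. In terms of
    the Euler-Lagrange equation: a nonnegative compactly supported
    superharmonic function, tested against a function equal to 1 on its
    support, must vanish.

    The competitor is only ever built from test functions. If phi_n, chi_n
    approximate u, v, the pair used is soft(phi_n(x / tau)) + t eta(x), and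
    the same with chi_n, where soft is a smooth approximation of the absolute
    value with derivative bounded by 1 (competitor, dirichlet_competitor,
    coupling_competitor). Along a subsequence converging almost everywhere,
    Fatou's lemma passes to the limit in the coupling, and one obtains
    (test_inequality), with q the infimum and p = 2^*(s),

      int F(x, |u| + t k, |v| + t k) dx <= ((energy + K t^2) / q)^(p/2).

    By density_gain the left side is at least coupling + c t with c > 0;
    since energy = q coupling^(2/p), linear_gain_contradiction concludes.

    This needs q > 0, that is, a minimizer with positive energy and with a
    finite, positive coupling. All three follow from Hardy's inequality
    (hardy_test), obtained by expanding the square |grad phi + phi X / 2|^2
    for the field X = x / (|x|^2 + e^2) and integrating by parts: it makes
    u^2 / |x|^2 integrable, and |u|^p / |x|^s is at most
    u^2 / |x|^2 + |u|^r with r = 2^*(0), where |u|^r is integrable because u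
    is an L^r limit of test functions. *)

(** * Borel sets, products and dilations of the Lebesgue measure *)

Section supnorm.
Context {R : realType} {n : nat}.

Lemma ler_coord_norm (x : 'rV[R]_n) i : `|x 0 i| <= `|x|.
Proof.
rewrite [leRHS](_ : _ = mx_norm x) // mx_normrE.
by apply: (le_bigmax _ (fun ij : 'I_1 * 'I_n => `|x ij.1 ij.2|) (ord0, i)).
Qed.

Lemma ler_norm_coord (x : 'rV[R]_n) M :
  0 <= M -> (forall i, `|x 0 i| <= M) -> `|x| <= M.
Proof.
move=> M0 xM; rewrite [leLHS](_ : _ = mx_norm x) // mx_normrE.
by apply/bigmax_leP; split => // -[i j] _ /=; rewrite ord1.
Qed.

End supnorm.

Section measurability.
Context {R : realType} {n : nat}.

Lemma measurable_rat_box (c : 'rV[rat]_n) (e : rat) :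
  measurable [set x : 'rV[R]_n | forall i, `|x 0 i - ratr (c 0 i)| < ratr e].
Proof.
rewrite (_ : [set x | _] = \bigcap_(i in [set: 'I_n])
    ((fun x : 'rV[R]_n => x 0 i : measurableTypeR R)
      @^-1` ball (ratr (c 0 i) : R) (ratr e))); last first.
  apply/seteqP; split => [x Hx i _|x Hx i].
    by rewrite /= /ball/= distrC; apply: Hx.
  by move: (Hx i I); rewrite /= /ball/= distrC.
apply: fin_bigcap_measurable => [|i _]; first exact: finite_finset.
rewrite -[X in measurable X]setTI.
apply: measurable_coord => //; rewrite ball_itv; exact: measurable_itv.
Qed.

(** An open set is the union of the countably many rational boxes that it
    contains, and a box is measurable for the product sigma-algebra. *)
Lemma open_measurable_rV (A : set 'rV[R]_n) : open A -> measurable A.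
Proof.
move=> oA.
pose B (ce : 'rV[rat]_n * rat) :=
  [set x : 'rV[R]_n | forall i, `|x 0 i - ratr (ce.1 0 i)| < ratr ce.2].
have -> : A = \bigcup_ce (if `[< B ce `<=` A >] then B ce else set0).
  apply/seteqP; split => [x Ax|x [ce _]]; last first.
    by case: ifPn => // /asboolP; apply.
  have /nbhs_ballP[e /= e0 eA] := open_nbhs_nbhs (conj oA Ax).
  have /rat_in_itvoo[q] : 0 < e / 2 by rewrite divr_gt0.
  rewrite in_itv/= => /andP[q0 qe].
  have /choice[c Hc] : forall i, exists r : rat, `|x 0 i - ratr r| < ratr q.
    move=> i; have /rat_in_itvoo[r] : x 0 i < x 0 i + ratr q by rewrite ltrDl.
    rewrite in_itv/= => /andP[r1 r2]; exists r.
    by rewrite distrC gtr0_norm ?subr_gt0// ltrBlDl.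
  exists (\row_i c i, q) => //; rewrite asboolT.
    by move=> i /=; rewrite mxE.
  move=> y By; apply: eA; split => // i j; rewrite /ball/= ord1.
  have := By j; have := Hc j; rewrite mxE /= => h1 h2.
  rewrite (_ : x 0 j - y 0 j =
    (x 0 j - ratr (c j)) - (y 0 j - ratr (c j))); last by ring.
  apply: le_lt_trans (ler_normB _ _) _; lra.
apply: countable_bigcupT_measurable; first exact: countableP.
by move=> ce; case: ifP => // _; exact: measurable_rat_box.
Qed.

Lemma closed_measurable_rV (A : set 'rV[R]_n) : closed A -> measurable A.
Proof.
move=> cA; rewrite -[X in measurable X]setCK; apply: measurableC.
by apply: open_measurable_rV; exact: closed_openC.
Qed.

Lemma measurable_rV_set1 (x : 'rV[R]_n) : measurable [set x].
Proof.
apply: closed_measurable_rV; apply: accessible_closed_set1.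
by apply: hausdorff_accessible; exact: norm_hausdorff.
Qed.

Lemma continuous_measurable_rV (f : 'rV[R]_n -> R) : continuous f ->
  measurable_fun setT (f : 'rV[R]_n -> measurableTypeR R).
Proof.
move=> /continuousP cf.
apply: (measurability _ (RGenOpens.measurableE R)).
move=> _ [_ [a [b ->] <-]]; rewrite setTI.
apply: open_measurable_rV; apply: cf; exact: interval_open.
Qed.

End measurability.

Section product.
Context {R : realType}.
Local Open Scope ereal_scope.

Lemma ge0_integral_rVS n (f : 'rV[R]_n.+1 -> \bar R) :
  measurable_fun setT f -> (forall x, 0 <= f x) ->
  \int[lebesgue_rV n.+1]_x f x =
  \int[@lebesgue_measure R]_a \int[lebesgue_rV n]_v f (rV_cons (a, v)).
Proof.
move=> mf f0.
rewrite [LHS](_ : _ = \int[@lebesgue_measure R \x lebesgue_rV n]_z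
   (f \o @rV_cons R n) z).
  rewrite fubini_tonelli1//=.
  by apply: (measurableT_comp mf); exact: measurable_rV_cons.
transitivity (\int[pushforward (@lebesgue_measure R \x lebesgue_rV n)
   (@rV_cons R n)]_x f x) => //.
rewrite (@ge0_integral_pushforward _ _ _ _ R _ (@measurable_rV_cons R n)) //.
Qed.

Lemma integrable_rVS n (f : 'rV[R]_n.+1 -> \bar R) :
  (lebesgue_rV n.+1).-integrable setT f ->
  (@lebesgue_measure R \x lebesgue_rV n).-integrable setT (f \o @rV_cons R n).
Proof.
move=> /integrableP[mf fi]; apply/integrableP; split.
  by apply: (measurableT_comp mf); exact: measurable_rV_cons.
apply: le_lt_trans fi.
rewrite (_ : \int[lebesgue_rV n.+1]_x _ =
  \int[pushforward (@lebesgue_measure R \x lebesgue_rV n)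
    (@rV_cons R n)]_x `|f x|) //.
rewrite (@ge0_integral_pushforward _ _ _ _ R _ (@measurable_rV_cons R n)) //.
exact: measurableT_comp.
Qed.

Lemma integral_rVS n (f : 'rV[R]_n.+1 -> \bar R) :
  (lebesgue_rV n.+1).-integrable setT f ->
  \int[lebesgue_rV n.+1]_x f x =
  \int[@lebesgue_measure R \x lebesgue_rV n]_z (f \o @rV_cons R n) z.
Proof.
move=> fi; have fi' := integrable_rVS fi; have /integrableP[mf _] := fi.
transitivity (\int[pushforward (@lebesgue_measure R \x lebesgue_rV n)
   (@rV_cons R n)]_x f x) => //.
by rewrite (@integral_pushforward _ _ _ _ R _ (@measurable_rV_cons R n)).
Qed.

(** The right-hand side is the integral against t times the image of the
    Lebesgue measure under a |-> t a, and this measure agrees with the Lebesgue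
    measure on intervals. *)
Lemma ge0_integral_scale1 (t : R) (f : R -> \bar R) : (0 < t)%R ->
  measurable_fun setT (f : measurableTypeR R -> \bar R) ->
  (forall x, 0 <= f x) ->
  \int[@lebesgue_measure R]_a f a =
  t%:E * \int[@lebesgue_measure R]_a f (t * a)%R.
Proof.
move=> t0 mf f0.
pose h (a : measurableTypeR R) : measurableTypeR R := (t * a)%R.
have mt : measurable_fun setT h by exact: mulrl_measurable.
have [t' tt'] : {t' : {nonneg R} | t'%:num = t} by exists (NngNum (ltW t0)).
pose m : {measure set (measurableTypeR R) -> \bar R} := mscale t'
  (measure_function_pushforward__canonical__measure_function_Measure
     (@lebesgue_measure R) mt).
transitivity (\int[m]_a f a).
  apply: eq_measure_integral => A mA _.
  apply: lebesgue_measure_unique => //= X [[a b] _ <-].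
  rewrite [RHS](_ : _ = t%:E * lebesgue_measure (h @^-1` `]a, b]%classic));
    last by rewrite -[X in _ = X%:E * _]tt'.
  rewrite (_ : _ @^-1` _ = `](t^-1 * a)%R, (t^-1 * b)%R]%classic); last first.
    apply/seteqP; split => x /=; rewrite !in_itv/= => /andP[h1 h2].
      by apply/andP; split; [rewrite ltr_pdivrMl|rewrite ler_pdivlMl].
    by apply/andP; split; [rewrite -ltr_pdivrMl|rewrite -ler_pdivlMl].
  rewrite !lebesgue_measure_itv/= !lte_fin ltr_pM2l ?invr_gt0//.
  case: ifPn => _; last by rewrite mule0.
  by rewrite -!EFinB -EFinM; congr EFin; field; rewrite gt_eqF.
rewrite ge0_integral_mscale//= [X in X%:E * _]tt'; congr (_ * _).
by rewrite (@ge0_integral_pushforward _ _ _ _ R _ mt).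
Qed.

Lemma measurable_rV_scale n (t : R) :
  measurable_fun setT (fun x : 'rV[R]_n => t *: x).
Proof.
apply: measurable_fun_rV => i.
under eq_fun do rewrite mxE.
apply: measurableT_comp (measurable_coord i); exact: mulrl_measurable.
Qed.

Lemma rV_cons_scale n (t a : R) (v : 'rV[R]_n) :
  (t *: rV_cons (a : measurableTypeR R, v))%R =
  rV_cons ((t * a)%R : measurableTypeR R, (t *: v)%R).
Proof.
apply/rowP => i; rewrite mxE; case: (unliftP 0%R i) => [j ->|->].
  by rewrite !rV_consS/= mxE.
by rewrite !rV_cons0.
Qed.

(** By Tonelli's theorem, one dimension at a time. *)
Lemma ge0_integral_scale n (t : R) (f : 'rV[R]_n -> \bar R) : (0 < t)%R ->
  measurable_fun setT f -> (forall x, 0 <= f x) ->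
  \int[lebesgue_rV n]_x f x = (t ^+ n)%:E * \int[lebesgue_rV n]_x f (t *: x)%R.
Proof.
move=> t0; elim: n f => [|n IH] f mf f0.
  rewrite expr0 mul1e; apply: eq_integral => x _.
  by congr f; apply/rowP => -[].
have mfs (g : 'rV[R]_n.+1 -> \bar R) (mg : measurable_fun setT g) a :
    measurable_fun setT
      (fun v : 'rV[R]_n => g (rV_cons (a : measurableTypeR R, v))).
  apply: measurableT_comp mg _.
  apply: measurableT_comp (@measurable_rV_cons R n) _.
  exact: pair1_measurable.
have mft : measurable_fun setT (fun x : 'rV[R]_n.+1 => f (t *: x)%R).
  by apply: (measurableT_comp mf); exact: measurable_rV_scale.
have mF (g : 'rV[R]_n.+1 -> \bar R) (mg : measurable_fun setT g)
   (g0 : forall x, 0 <= g x) :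
    measurable_fun setT (fun a : measurableTypeR R =>
      \int[lebesgue_rV n]_v g (rV_cons (a, v))).
  apply: (@measurable_fun_fubini_tonelli_F _ _ _ _ R (lebesgue_rV n)
            (g \o @rV_cons R n)).
    by apply: measurableT_comp mg _; exact: measurable_rV_cons.
  by move=> x; exact: g0.
rewrite !ge0_integral_rVS//.
rewrite (ge0_integral_scale1 t0); last 2 first.
- exact: (mF _ mf f0).
- by move=> a; apply: integral_ge0.
rewrite exprS EFinM -muleA; congr (_ * _).
rewrite -ge0_integralZl//; last 3 first.
- exact: (mF _ mft (fun x => f0 _)).
- by move=> a _; apply: integral_ge0.
- by rewrite lee_fin exprn_ge0// ltW.
apply: eq_integral => a _.
rewrite IH//; last exact: mfs.
congr (_ * _); apply: eq_integral => v _.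
by rewrite rV_cons_scale.
Qed.

Lemma lebesgue_rV_set1_0 n : (0 < n)%N -> @lebesgue_rV R n [set 0%R] = 0.
Proof.
case: n => // n _.
rewrite /= /lebesgue_rV_step /pushforward.
apply/eqP; rewrite eq_le measure_ge0 andbT.
have sub : @rV_cons R n @^-1` [set 0%R] `<=` [set 0%R] `*` setT.
  move=> [a v] /= /(congr1 (fun x : 'rV_n.+1 => x 0%R 0%R)).
  by rewrite rV_cons0 mxE.
have mpre : measurable (@rV_cons R n @^-1` [set 0%R]).
  rewrite -[X in measurable X]setTI; apply: measurable_rV_cons => //.
  exact: measurable_rV_set1.
apply: le_trans (le_measure _ _ _ sub) _; rewrite ?inE//.
  exact: measurableX.
rewrite [leLHS](_ : _ = (@lebesgue_measure R \x lebesgue_rV n)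
  ([set 0%R] `*` setT))//.
rewrite product_measure1E//.
by rewrite [X in X * _](_ : _ = 0) ?mul0e//; exact: lebesgue_measure_set1.
Qed.

Lemma lebesgue_rV_bounded n (A : set 'rV[R]_n) :
  measurable A -> bounded_set A -> lebesgue_rV n A < +oo.
Proof.
move=> mA [M0 [_ HM0]].
pose M := (M0 + 1)%R.
have HM x : A x -> (`|x| <= M)%R by apply: HM0; rewrite ltrDl.
pose B k := [set x : 'rV[R]_k | (forall i, `|x ord0 i| <= M)%R].
have mB k : measurable (B k).
  rewrite (_ : B k = \bigcap_(i in [set: 'I_k])
    ((fun x : 'rV[R]_k => x ord0 i : measurableTypeR R)
      @^-1` `[(- M)%R, M]%classic)); last first.
    apply/seteqP; split => [x Hx i _|x Hx i].
      by have := Hx i; rewrite /= in_itv/= ler_norml.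
    by have := Hx i I; rewrite /= in_itv/= ler_norml.
  apply: fin_bigcap_measurable => [|i _]; first exact: finite_finset.
  by rewrite -[X in measurable X]setTI; apply: measurable_coord.
have finB k : @lebesgue_rV R k (B k) < +oo.
  elim: k => [|k IH]; first by rewrite /= diracE ltry.
  rewrite /= /lebesgue_rV_step /pushforward.
  rewrite (_ : _ @^-1` _ = `[(- M)%R, M]%classic `*` B k); last first.
    apply/seteqP; split => -[a v] /=.
      move=> Hx; split.
        by have := Hx ord0; rewrite rV_cons0 in_itv/= ler_norml.
      by move=> i; have := Hx (lift ord0 i); rewrite rV_consS.
    move=> [Ha Hv] i; case: (unliftP 0%R i) => [j ->|->].
      by rewrite rV_consS; apply: Hv.
    by rewrite rV_cons0; move: Ha; rewrite in_itv/= ler_norml.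
  rewrite product_measure1E//; last exact: mB.
  rewrite lte_mul_pinfty//.
  rewrite ge0_fin_numE//; have := @lebesgue_measure_itv R `[(- M)%R, M].
  rewrite /=; case: ifP => _.
    by rewrite -EFinB => ->; rewrite ltry.
  by move=> ->; rewrite ltry.
apply: le_lt_trans (finB n); apply: le_measure; rewrite ?inE//; first exact: mB.
by move=> x /HM /= xM i; exact: le_trans (ler_coord_norm x i) xM.
Qed.

End product.

(** * Integration by parts *)

Section bounded_support.
Context {R : realType} {n : nat}.

Lemma compact_norm_le (M : R) : compact [set x : 'rV[R]_n | `|x| <= M].
Proof.
apply: bounded_closed_compact.
  exists M; split; first exact: num_real.
  by move=> x Mx y /= /le_trans; apply; exact: ltW.
apply: (@preimage_closed _ _ (fun x : 'rV[R]_n => `|x|) [set a | a <= M]);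
  last exact: closed_le.
by move=> x _; exact: norm_continuous.
Qed.

Lemma integrable_continuous_bounded_support (g : 'rV[R]_n -> R) M :
  continuous g -> (forall x, g x != 0 -> `|x| <= M) ->
  (lebesgue_rV n).-integrable setT (EFin \o g).
Proof.
move=> cg gM; pose B := [set x : 'rV[R]_n | `|x| <= M].
have cB : compact B := @compact_norm_le M.
have mB : measurable B.
  apply: closed_measurable_rV.
  by apply: compact_closed => //; exact: norm_hausdorff.
have gB : EFin \o g = (EFin \o g) \_ B.
  apply/funext => x; rewrite patchE; case: ifPn => // /negP xB /=.
  congr EFin; apply/eqP; apply: contraPT isT => /gM xM.
  by case: xB; rewrite inE.
rewrite gB; apply/(integrable_mkcond _ mB).
apply: measurable_bounded_integrable => //.
- apply: lebesgue_rV_bounded => //.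
  exists M; split; first exact: num_real.
  by move=> x Mx y /= /le_trans; apply; exact: ltW.
- by apply: measurable_funTS; exact: continuous_measurable_rV.
- have : compact (g @` B).
    by apply: continuous_compact => //; apply: continuous_subspaceT.
  move=> /compact_bounded [K [Kr HK]]; exists K; split => // x Kx y By.
  by apply: HK => //; exists y.
Qed.

End bounded_support.

Section ibp.
Context {R : realType}.
Local Notation mu := (@lebesgue_measure R).

Lemma integral_derive1_eq0 (h : R -> R) (M : R) :
  (forall a, derivable h a 1) -> continuous (derive1 h) ->
  (forall a, h a != 0 -> `|a| <= M) ->
  (\int[mu]_a ((derive1 h) a)%:E = 0)%E.
Proof.
move=> dh ch hM.
have ch0 : continuous h.
  by move=> a; apply: differentiable_continuous; apply/derivable1_diffP.
have h0 a : M < `|a| -> h a = 0.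
  move=> Ma; apply/eqP; apply: contraTT Ma => /hM; by rewrite -leNgt.
have h'0 a : M < `|a| -> (derive1 h) a = 0.
  move=> Ma; rewrite derive1E (@near_eq_derive _ _ _ h (cst 0)) ?derive_cst//.
  have oM : open [set x : R | M < `|x|].
    apply: (@open_comp _ _ (fun x : R => `|x|) [set y | M < y]);
      last exact: open_gt.
    by move=> x _; exact: norm_continuous.
  near=> x; apply: h0; near: x.
  exact: open_nbhs_nbhs.
pose b := `|M| + 1.
have b0 : - b < b by rewrite /b; have := normr_ge0 M; lra.
have Mb : M < b by rewrite /b; have := ler_norm M; lra.
have bp : 0 < b by rewrite /b; have := normr_ge0 M; lra.
have hb : h b = 0 by apply: h0; rewrite gtr0_norm.
have hNb : h (- b) = 0 by apply: h0; rewrite normrN gtr0_norm.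
have cLR : derivable_oo_LRcontinuous h (- b) b.
  split.
  - by move=> a _; exact: dh.
  - by apply: cvg_at_right_filter; exact: ch0.
  - by apply: cvg_at_left_filter; exact: ch0.
have cw : {within `[- b, b], continuous (derive1 h)}.
  exact: continuous_subspaceT.
have := continuous_FTC2 b0 cw cLR (fun _ _ => erefl).
rewrite hb hNb subee// => <-.
rewrite [RHS]integral_mkcond; apply: eq_integral => a _.
rewrite patchE; case: ifPn => // /negP ab; congr EFin; apply: h'0.
rewrite ltNge; apply/negP => aM; apply: ab; rewrite inE/= in_itv/= -ler_norml.
by apply: (le_trans aM); exact: ltW.
Unshelve. all: by end_near. Qed.

Lemma slice_partial n (f : 'rV[R]_n.+1 -> R) (a : R) j (v : 'rV[R]_n) :
  let g v := f (rV_cons (a : measurableTypeR R, v)) in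
  (derivable f (rV_cons (a : measurableTypeR R, v)) (delta_mx 0 (lift 0 j)) ->
   derivable g v (delta_mx 0 j)) /\
  partial j g v = partial (lift 0 j) f (rV_cons (a : measurableTypeR R, v)).
Proof.
move=> g; rewrite /partial /derivable /derive.
have -> : (fun h : R => h^-1 *:
   ((f \o shift (rV_cons (a : measurableTypeR R, v)))
     (h *: delta_mx 0 (lift 0 j)) - f (rV_cons (a : measurableTypeR R, v)))) =
   (fun h => h^-1 *: ((g \o shift v) (h *: delta_mx 0 j) - g v)) => //.
apply/funext => h /=; congr (_ *: (f _ - _)).
apply/rowP => i; rewrite mxE; case: (unliftP 0 i) => [k ->|->].
  by rewrite !rV_consS/= !mxE/= (inj_eq lift_inj).
by rewrite !rV_cons0 !mxE/= mulr0 add0r.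
Qed.

Lemma slice_partial0 n (f : 'rV[R]_n.+1 -> R) (a : R) (v : 'rV[R]_n) :
  let g a := f (rV_cons (a : measurableTypeR R, v)) in
  (derivable f (rV_cons (a : measurableTypeR R, v)) (delta_mx 0 0) ->
   derivable g a 1) /\
  derive1 g a = partial 0 f (rV_cons (a : measurableTypeR R, v)).
Proof.
move=> g; rewrite derive1E /partial /derivable /derive.
have -> : (fun h : R => h^-1 *:
   ((f \o shift (rV_cons (a : measurableTypeR R, v)))
     (h *: delta_mx 0 0) - f (rV_cons (a : measurableTypeR R, v)))) =
   (fun h => h^-1 *: ((g \o shift a) (h *: 1) - g a)) => //.
apply/funext => h /=; congr (_ *: (f _ - _)).
apply/rowP => i; rewrite mxE; case: (unliftP 0 i) => [k ->|->].
  by rewrite !rV_consS/= !mxE/= mulr0 add0r.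
by rewrite !rV_cons0 !mxE/=.
Qed.

Lemma rV_cons_continuousr n (a : R) :
  continuous (fun v : 'rV[R]_n => rV_cons (a : measurableTypeR R, v)).
Proof.
move=> v; apply/(@cvgrPdist_le _ _ _ (nbhs v) (nbhs_filter v)) => e e0.
near=> w.
apply: ler_norm_coord; first exact: ltW.
move=> i; rewrite mxE [X in _ + X]mxE; case: (unliftP 0 i) => [k ->|->].
  rewrite !rV_consS/=.
  rewrite (_ : _ - _ = (v - w) 0 k); last by rewrite !mxE.
  apply: le_trans (ler_coord_norm _ _) _.
  by near: w; apply: cvgr_dist_le.
by rewrite !rV_cons0 subrr normr0 ltW.
Unshelve. all: by end_near. Qed.

Lemma rV_cons_continuousl n (v : 'rV[R]_n) :
  continuous (fun a : R => rV_cons (a : measurableTypeR R, v)).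
Proof.
move=> a; apply/cvgrPdist_le => e e0; near=> b.
apply: ler_norm_coord; first exact: ltW.
move=> i; rewrite mxE [X in _ + X]mxE; case: (unliftP 0 i) => [k ->|->].
  by rewrite !rV_consS/= subrr normr0 ltW.
rewrite !rV_cons0/=.
by near: b; apply: cvgr_dist_le.
Unshelve. all: by end_near. Qed.

Lemma partial_eq0 n (f : 'rV[R]_n -> R) i x (U : set 'rV[R]_n) :
  open U -> U x -> (forall y, U y -> f y = 0) -> partial i f x = 0.
Proof.
move=> oU Ux f0.
rewrite /partial (@near_eq_derive _ _ _ f (cst 0)) ?derive_cst//.
by near=> y; apply: f0; near: y; exact: open_nbhs_nbhs.
Unshelve. all: by end_near. Qed.

Lemma open_norm_gt n (M : R) : open [set x : 'rV[R]_n | M < `|x|].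
Proof.
apply: (@open_comp _ _ (fun x : 'rV[R]_n => `|x|) [set y | M < y]);
  last exact: open_gt.
by move=> x _; exact: norm_continuous.
Qed.

Lemma partial_support n (f : 'rV[R]_n -> R) i M :
  (forall x, f x != 0 -> `|x| <= M) ->
  (forall x, partial i f x != 0 -> `|x| <= M).
Proof.
move=> fM x; apply: contraR; rewrite -ltNge => xM; apply/eqP.
apply: (partial_eq0 _ (@open_norm_gt n M)) => // y My.
by apply/eqP; apply: contraTT My => /fM; rewrite -leNgt.
Qed.

(** Fubini's theorem reduces the claim, coordinate by coordinate, to the
    fundamental theorem of calculus on the line. *)
Lemma integral_partial_eq0 n (i : 'I_n) (f : 'rV[R]_n -> R) M :
  (forall x, derivable f x (delta_mx 0 i)) -> continuous (partial i f) ->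
  (forall x, f x != 0 -> `|x| <= M) ->
  (\int[lebesgue_rV n]_x (partial i f x)%:E = 0)%E.
Proof.
elim: n i f => [[]//|n IH] i f df cdf fM.
have idf : (lebesgue_rV n.+1).-integrable setT (EFin \o partial i f).
  exact: integrable_continuous_bounded_support cdf (partial_support fM).
have Hi := integrable_rVS idf; rewrite (integral_rVS idf) {idf}.
case: (unliftP 0 i) => [j ij|i0]; subst i.
  rewrite -integral12_prod_meas1//; apply: integral0_eq => a _.
  rewrite /fubini_F.
  transitivity (\int[lebesgue_rV n]_v
      (partial j (fun v => f (rV_cons (a : measurableTypeR R, v))) v)%:E)%E.
    by apply: eq_integral => v _; rewrite (slice_partial f a j v).2.
  apply: IH.
  - by move=> v; apply: (slice_partial f a j v).1.
  - rewrite (_ : partial _ _ = partial (lift 0 j) f \o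
        (fun v => rV_cons (a : measurableTypeR R, v))).
      by move=> v; apply: continuous_comp; [exact: rV_cons_continuousr|exact: cdf].
    by apply/funext => v; rewrite (slice_partial f a j v).2.
  - move=> v /fM vM; apply: ler_norm_coord; first exact: le_trans vM.
    move=> k; have := le_trans (ler_coord_norm _ (lift 0 k)) vM.
    by rewrite rV_consS.
rewrite -integral21_prod_meas1//; apply: integral0_eq => v _.
rewrite /fubini_G.
transitivity (\int[lebesgue_measure]_a
    (derive1 (fun a : R => f (rV_cons (a : measurableTypeR R, v))) a)%:E)%E.
  by apply: eq_integral => a _; rewrite (slice_partial0 f a v).2.
apply: (integral_derive1_eq0 (M := M)).
- by move=> a; apply: (slice_partial0 f a v).1.
- rewrite (_ : derive1 _ = partial 0 f \o
      (fun a => rV_cons (a : measurableTypeR R, v))).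
    by move=> a; apply: continuous_comp; [exact: rV_cons_continuousl|exact: cdf].
  by apply/funext => a; rewrite (slice_partial0 f a v).2.
- move=> a /fM vM; have := le_trans (ler_coord_norm _ 0) vM.
  by rewrite rV_cons0.
Qed.

End ibp.

(** * Smooth functions *)

Section smooth_closure.
Context {R : realType} {N : nat}.
Implicit Types (f g : 'rV[R]_N -> R) (P B : ('rV[R]_N -> R) -> Prop).

Definition C1 f := continuous f /\ forall i x, derivable f x (delta_mx 0 i).

(** Smoothness is the largest class of C1 functions closed under partial
    derivatives, so it is established by exhibiting such a class. *)
Lemma smooth_coind P :
  (forall f, P f -> C1 f /\ forall i, P (partial i f)) ->
  forall f, P f -> smooth f.
Proof.
move=> HP f Pf s g; rewrite {}/g.
suff : P (foldr partial f s) by move=> /HP[].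
by elim: s => //= i s /HP[].
Qed.

Lemma smooth_C1 f : smooth f -> C1 f.
Proof. by move=> /(_ [::]). Qed.

Lemma smooth_partial i f : smooth f -> smooth (partial i f).
Proof.
by move=> sf s; have := sf (rcons s i); rewrite /= foldr_rcons.
Qed.

(** The algebra generated by a class of functions. By the product rule it is
    closed under partial derivatives as soon as it contains those of its
    generators, which is how all closure properties below are obtained. *)
Inductive algebra B : ('rV[R]_N -> R) -> Prop :=
| algebra_base f : B f -> algebra B f
| algebra_cst c : algebra B (cst c)
| algebra_add f g : algebra B f -> algebra B g -> algebra B (f + g)
| algebra_mul f g : algebra B f -> algebra B g -> algebra B (f * g).

Lemma smooth_algebra B :
  (forall f, B f -> C1 f /\ forall i, algebra B (partial i f)) ->
  forall f, algebra B f -> smooth f.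
Proof.
move=> HB; apply: smooth_coind => f.
elim=> {f} [f /HB//|c|f g _ [[cf df] pf] _ [[cg dg] pg]
  |f g Hf [[cf df] pf] Hg [[cg dg] pg]].
- split; first by split => [x|i x]; [exact: cst_continuous|exact: derivable_cst].
  move=> i; rewrite (_ : partial i _ = cst 0); first exact: algebra_cst.
  by apply/funext => x; rewrite /partial derive_cst.
- split.
    split => [x|i x]; last exact: derivableD.
    by apply: continuousD; [exact: cf|exact: cg].
  move=> i; rewrite (_ : partial i _ = partial i f + partial i g).
    exact: algebra_add.
  by apply/funext => x; rewrite /partial deriveD.
- split.
    split => [x|i x]; last exact: derivableM.
    by apply: continuousM; [exact: cf|exact: cg].
  move=> i; rewrite (_ : partial i _ = f * partial i g + g * partial i f).
    by apply: algebra_add; apply: algebra_mul.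
  by apply/funext => x; rewrite /partial deriveM.
Qed.

Lemma smooth_smooth_algebra f : algebra smooth f -> smooth f.
Proof.
apply: smooth_algebra => g sg; split; first exact: smooth_C1.
by move=> i; apply: algebra_base; exact: smooth_partial.
Qed.

Lemma smoothD f g : smooth f -> smooth g -> smooth (f + g).
Proof.
by move=> sf sg; apply: smooth_smooth_algebra; apply: algebra_add; apply: algebra_base.
Qed.

Lemma smoothM f g : smooth f -> smooth g -> smooth (f * g).
Proof.
by move=> sf sg; apply: smooth_smooth_algebra; apply: algebra_mul; apply: algebra_base.
Qed.

Lemma smooth_cst c : smooth (cst c : 'rV[R]_N -> R).
Proof. by apply: smooth_smooth_algebra; apply: algebra_cst. Qed.

Lemma is_derive_mull (c y : R) : is_derive y 1 (fun h : R => c * h) c.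
Proof.
have := @is_deriveZ R R R id c y 1 1 (is_derive_id _ _).
by rewrite [c *: 1]mulr1.
Qed.

Lemma derive_line f x v :
  (derivable f x v <-> derivable (fun h : R => f (h *: v + x)) 0 1) /\
  'D_v f x = 'D_1 (fun h : R => f (h *: v + x)) 0.
Proof.
rewrite /derivable /derive.
have -> // : (fun h : R => h^-1 *: ((f \o shift x) (h *: v) - f x)) =
  (fun h => h^-1 *: (((fun h : R => f (h *: v + x)) \o shift 0) (h *: 1)
    - (f (0 *: v + x)))).
by apply/funext => h /=; rewrite addr0 scale0r add0r /GRing.scale/= mulr1.
Qed.

Lemma is_derive_line f x v l :
  is_derive x v f l <-> is_derive (0 : R) 1 (fun h : R => f (h *: v + x)) l.
Proof.
have [H1 H2] := derive_line f x v.
split => -[d1 d2].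
  exact: DeriveDef (H1.1 d1) (etrans (esym H2) d2).
exact: DeriveDef (H1.2 d1) (etrans H2 d2).
Qed.

Lemma is_derive_comp_line (G : R -> R) f x v (a b : R) :
  is_derive (f x) 1 G a -> is_derive x v f b -> is_derive x v (G \o f) (a * b).
Proof.
move=> HG /is_derive_line Hf; apply/is_derive_line.
rewrite (_ : (fun _ => _) = G \o (fun h => f (h *: v + x))) //.
apply: is_derive1_comp => //.
by rewrite scale0r add0r.
Qed.

Lemma is_derive_scale f c x v b :
  is_derive (c *: x) v f b -> is_derive x v (fun y => f (c *: y)) (c * b).
Proof.
move=> /is_derive_line Hf; apply/is_derive_line.
rewrite (_ : (fun _ => _) =
  (fun h => f (h *: v + c *: x)) \o (fun h => c * h)); last first.
  by apply/funext => h /=; rewrite scalerDr scalerA.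
rewrite mulrC; apply: is_derive1_comp.
  by rewrite mulr0.
exact: is_derive_mull.
Qed.

Lemma is_derive_partial f x i : derivable f x (delta_mx 0 i) ->
  is_derive x (delta_mx 0 i) f (partial i f x).
Proof. exact: derivableP. Qed.

Lemma partial_is_derive f x i l :
  is_derive x (delta_mx 0 i) f l -> partial i f x = l.
Proof. by move=> ?; rewrite /partial derive_val. Qed.

Section compose.
Variables (D : set R) (GG : (R -> R) -> Prop).
Hypothesis GGderive : forall G, GG G -> exists c1 G1 c2 G2,
  [/\ GG G1, GG G2 & forall y, D y -> is_derive y 1 G (c1 * G1 y + c2 * G2 y)].

(** The functions of one variable met below, powers on the positive half-line
    and flat functions, come in families GG in which each derivative is a
    combination of at most two members of the family. *)
Lemma smooth_comp G f : GG G -> smooth f -> (forall x, D (f x)) -> smooth (G \o f).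
Proof.
move=> GGG sf Df.
pose B g := smooth g \/ exists G, GG G /\ g = G \o f.
suff : forall g, algebra B g -> smooth g.
  by apply; apply: algebra_base; right; exists G.
apply: smooth_algebra => {G GGG} g [sg|[G [GGG ->]]].
  split; first exact: smooth_C1.
  by move=> i; apply: algebra_base; left; apply: smooth_partial.
have [c1 [G1 [c2 [G2 [GG1 GG2 GE]]]]] := GGderive GGG.
have dGf i x : is_derive x (delta_mx 0 i) (G \o f)
    ((c1 * G1 (f x) + c2 * G2 (f x)) * partial i f x).
  apply: is_derive_comp_line; first exact: GE.
  by apply: is_derive_partial; apply: (smooth_C1 sf).2.
split; first split.
- move=> x; apply: continuous_comp; first exact: (smooth_C1 sf).1.
  apply: differentiable_continuous; apply/derivable1_diffP.
  by have [] := GE _ (Df x).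
- by move=> i x; have [] := dGf i x.
- move=> i; rewrite (_ : partial i _ =
    (cst c1 * (G1 \o f) + cst c2 * (G2 \o f)) * partial i f).
    apply: algebra_mul; last by apply: algebra_base; left; apply: smooth_partial.
    apply: algebra_add; (apply: algebra_mul; first exact: algebra_cst);
      by apply: algebra_base; right; eexists; split; [|reflexivity].
  by apply/funext => x; rewrite (partial_is_derive (dGf i x)).
Qed.

End compose.

Lemma smooth_powR f a : smooth f -> (forall x, 0 < f x) ->
  smooth (fun x => f x `^ a).
Proof.
move=> sf f0.
pose GG (G : R -> R) := exists b, G = (fun y : R => y `^ b).
apply: (@smooth_comp [set y | 0 < y] GG _ (fun y : R => y `^ a) f) => //;
  last by exists a.
move=> _ [b ->]; exists b, (fun y : R => y `^ (b - 1)).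
exists 0, (fun y : R => y `^ (b - 1)); split.
- by eexists.
- by eexists.
- by move=> y y0; rewrite mul0r addr0; exact: is_derive1_powR.
Qed.

Lemma smooth_scale f c : smooth f -> smooth (fun x => f (c *: x)).
Proof.
move=> sf; pose P g := exists a f, smooth f /\ g = (fun x => a * f (c *: x)).
apply: (@smooth_coind P); last first.
  by exists 1, f; split => //; apply/funext => x; rewrite mul1r.
move=> _ [a [{sf} {}f [sf ->]]].
have dg i x : is_derive x (delta_mx 0 i) (fun x => a * f (c *: x))
    (a * c * partial i f (c *: x)).
  rewrite -mulrA; apply: is_deriveZ; apply: is_derive_scale.
  by apply: is_derive_partial; apply: (smooth_C1 sf).2.
split; first split.
- move=> x; apply: continuousM; first exact: cst_continuous.
  apply: (@continuous_comp 'rV[R]_N 'rV[R]_N R (fun y => c *: y) f x).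
    exact: scaler_continuous.
  exact: (smooth_C1 sf).1.
- by move=> i x; have [] := dg i x.
- move=> i; exists (a * c), (partial i f); split; first exact: smooth_partial.
  by apply/funext => x; rewrite (partial_is_derive (dg i x)).
Qed.

Lemma is_derive_coord (j i : 'I_N) (x : 'rV[R]_N) :
  is_derive x (delta_mx 0 i) (fun y : 'rV[R]_N => y 0 j) ((i == j)%:R).
Proof.
apply/is_derive_line.
rewrite (_ : (fun _ => _) =
  (fun h : R => h * (i == j)%:R + x 0 j)); last first.
  by apply/funext => h; rewrite !mxE eqxx/= eq_sym.
rewrite -[X in is_derive _ _ _ X]addr0.
apply: (@is_deriveD _ _ _ (fun h : R => h * _) (cst (x 0 j))).
rewrite (_ : (fun _ => _) = (fun h => (i == j)%:R * h)); last first.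
  by apply/funext => h; rewrite mulrC.
exact: is_derive_mull.
Qed.

Lemma smooth_coord (j : 'I_N) : smooth (fun y : 'rV[R]_N => y 0 j).
Proof.
pose B (g : 'rV[R]_N -> R) := g = (fun y => y 0 j).
apply: (@smooth_algebra B); last exact: algebra_base.
move=> _ ->; split; first split.
- by move=> x; exact: coord_continuous.
- by move=> i x; have [] := is_derive_coord j i x.
- move=> i; rewrite (_ : partial i _ = cst ((i == j)%:R)).
    exact: algebra_cst.
  by apply/funext => x; rewrite (partial_is_derive (is_derive_coord j i x)).
Qed.

(** The norm `|x| of a row vector is the sup norm, which is not smooth; the
    square of the Euclidean norm is. *)
Definition sqnorm (x : 'rV[R]_N) : R := \sum_i x 0 i ^+ 2.

Lemma smooth_sum (I : Type) (r : seq I) (F : I -> 'rV[R]_N -> R) :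
  (forall i, smooth (F i)) -> smooth (fun x => \sum_(i <- r) F i x).
Proof.
move=> sF; elim: r => [|i r IH].
  rewrite (_ : (fun _ => _) = cst 0); first exact: smooth_cst.
  by apply/funext => x; rewrite big_nil.
rewrite (_ : (fun _ => _) = F i + (fun x => \sum_(i <- r) F i x)).
  exact: (smoothD (sF i) IH).
by apply/funext => x; rewrite big_cons.
Qed.

Lemma smooth_sqnorm : smooth sqnorm.
Proof.
apply: smooth_sum => i.
exact: smoothM (smooth_coord i) (smooth_coord i).
Qed.

End smooth_closure.

Section bump.
Context {R : realType}.

(** The derivatives of exp(- 1 / y), extended by 0 to y <= 0, are combinations
    of these functions. *)
Definition flat k (y : R) : R := if 0 < y then y^-1 ^+ k * expR (- y^-1) else 0.

Lemma flat_ge0 k y : 0 <= flat k y.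
Proof.
rewrite /flat; case: ifPn => // y0.
by rewrite mulr_ge0// ?expR_ge0// exprn_ge0// invr_ge0 ltW.
Qed.

(** The exponential beats every power of 1 / y; a quadratic bound suffices for
    flat k to be differentiable at 0 with derivative 0. *)
Lemma flat_le k y : flat k y <= (k.+2)`!%:R * `|y| ^+ 2.
Proof.
rewrite /flat; case: ifPn => y0; last by rewrite mulr_ge0// exprn_ge0.
rewrite (gtr0_norm y0) expRN.
have y1 : 0 < y^-1 by rewrite invr_gt0.
rewrite ler_pdivrMr ?expR_gt0//.
have := expR_ge1Dxn k.+1 (ltW y1) => H.
have F0 : 0 < k.+2`!%:R :> R by rewrite ltr0n fact_gt0.
have H2 : y^-1 ^+ k.+2 / k.+2`!%:R <= expR y^-1.
  by apply: le_trans H; rewrite lerDr.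
apply: (@le_trans _ _
  (k.+2`!%:R * y ^+ 2 * (y^-1 ^+ k.+2 / k.+2`!%:R))); last first.
  by rewrite ler_pM2l// mulr_gt0// exprn_gt0.
rewrite le_eqVlt; apply/orP; left; apply/eqP.
rewrite -addn2 exprD exprVn [y^-1 ^+ 2]exprVn; field.
by rewrite !expf_neq0 ?gt_eqF.
Qed.

Lemma flat_derive k (y : R) :
  is_derive y (1 : R) (flat k) (- k%:R * flat k.+1 y + 1 * flat k.+2 y).
Proof.
have [y0|y0|->] := ltrgtP y 0.
- rewrite /flat ltNge (ltW y0)/= !mulr0 addr0.
  apply: (@near_eq_is_derive _ _ _ (cst 0)) => //.
  near=> z; rewrite ifF//; apply/negbTE; rewrite -leNgt; near: z.
  exact: lt_le_nbhsl.
- rewrite /flat y0.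
  apply: (@near_eq_is_derive _ _ _
      ((fun w : R => w ^+ k * expR (- w)) \o (fun z : R => z^-1))) => //.
    near=> z; rewrite /= ifT//; near: z; exact: lt_nbhsr.
  have yV : y^-1 != 0 by rewrite invr_eq0 gt_eqF.
  have d1 : is_derive y (1:R) (fun z : R => z^-1) (- y ^- 2 *: 1).
    apply: (@is_deriveV _ (fun z => z)); by rewrite gt_eqF.
  have d2 : is_derive y^-1 (1:R) (fun w : R => w ^+ k * expR (- w))
     (k%:R * y^-1 ^+ k.-1 * expR (- y^-1) - y^-1 ^+ k * expR (- y^-1)).
    have e1 : is_derive y^-1 (1:R) (fun w : R => w ^+ k) (k%:R * y^-1 ^+ k.-1).
      rewrite -[X in is_derive _ _ _ X]mulr1 -(exprfctE (@id R) k).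
      exact: is_deriveX.
    have e2 : is_derive y^-1 (1:R) (fun w : R => expR (- w)) (- expR (- y^-1)).
      rewrite -[X in is_derive _ _ _ X]mulrN1.
      exact: (@is_derive1_comp _ expR (fun w => - w)).
    apply: (is_derive_eq (is_deriveM e1 e2)).
    by rewrite /GRing.scale/=; ring.
  apply: (is_derive_eq (is_derive1_comp d2 d1)).
  rewrite [_ *: 1]mulr1 -exprVn; case: k {d2} => [|k] /=.
    by rewrite !mul0r expr0; ring.
  by rewrite !exprS; ring.
- have f0 j : flat j 0 = 0 by rewrite /flat ltxx.
  rewrite !f0 !mulr0 addr0.
  have cv : (fun h : R => h^-1 *:
      ((flat k \o shift 0) (h *: 1) - flat k 0)) @ 0^' --> (0 : R).
    apply/cvgrPdist_le => e e0.
    have C0 : 0 < k.+2`!%:R :> R by rewrite ltr0n fact_gt0.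
    near=> h.
    rewrite /= f0 addr0 subr0 sub0r normrN [h *: 1]mulr1 [_ *: _]/(_ * _).
    have hn0 : 0 < `|h| by rewrite normr_gt0; near: h; exact: nbhs_dnbhs_neq.
    rewrite normrM normfV (ger0_norm (flat_ge0 _ _)) ler_pdivrMl//.
    apply: le_trans (flat_le _ _) _; rewrite expr2 mulrCA ler_pM2l//.
    rewrite -ler_pdivlMl//; near: h; exists (k.+2`!%:R^-1 * e).
      by rewrite /= mulr_gt0 ?invr_gt0.
    by move=> h /=; rewrite sub0r normrN => /ltW.
  by apply: DeriveDef; [apply/cvg_ex; exists 0|exact: cvg_lim].
Unshelve. all: by end_near. Qed.

Lemma flat_mono x y : x <= y -> flat 0 x <= flat 0 y.
Proof.
rewrite /flat; case: ltP => x0; case: ltP => y0 //.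
- by move=> xy; rewrite !expr0 !mul1r ler_expR lerN2 lef_pV2.
- by move=> xy; have := lt_le_trans x0 (le_trans xy y0); rewrite ltxx.
- by move=> _; rewrite mulr_ge0// expR_ge0.
Qed.

Lemma smooth_flat N (f : 'rV[R]_N -> R) : smooth f -> smooth (flat 0 \o f).
Proof.
move=> sf; pose GG (G : R -> R) := exists k, G = flat k.
apply: (@smooth_comp R N setT GG _ (flat 0) f) => //; last by exists 0%N.
move=> _ [k ->]; exists (- k%:R), (flat k.+1), 1, (flat k.+2); split.
- by eexists.
- by eexists.
- by move=> y _; exact: flat_derive.
Qed.

End bump.

(** * Hardy's inequality for test functions *)

Section hardy.
Context {R : realType} {N : nat}.
Implicit Types (f phi : 'rV[R]_N -> R).

Lemma sqnorm_ge0 (x : 'rV[R]_N) : 0 <= sqnorm x.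
Proof. by apply: sumr_ge0 => i _; exact: sqr_ge0. Qed.

Lemma enorm2 (x : 'rV[R]_N) : enorm x ^+ 2 = sqnorm x.
Proof. by rewrite /enorm sqr_sqrtr// sqnorm_ge0. Qed.

Lemma is_derive_sqnorm i (x : 'rV[R]_N) :
  is_derive x (delta_mx 0 i) (@sqnorm R N) (2 * x 0 i).
Proof.
have H : is_derive x (delta_mx 0 i) (\sum_j (fun y : 'rV[R]_N => y 0 j ^+ 2))
    (\sum_j (x 0 j *: (i == j)%:R + x 0 j *: (i == j)%:R)).
  apply: is_derive_sum => j.
  have d := is_derive_coord j i x.
  exact: (is_deriveM d d).
rewrite (_ : @sqnorm R N = \sum_j (fun y : 'rV[R]_N => y 0 j ^+ 2)); last first.
  by apply/funext => y; rewrite /sqnorm fct_sumE.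
apply: (is_derive_eq H); rewrite (bigD1 i)//= big1 => [|j ji].
  by rewrite eqxx addr0 -[_ *: 1]/(_ * 1); ring.
by rewrite eq_sym (negbTE ji) scaler0 addr0.
Qed.

(** The weight 1 / |x|^2 of Hardy's inequality, regularized at 0 so that the
    vector field x / (|x|^2 + e^2) is smooth. *)
Definition hweight (e : R) (x : 'rV[R]_N) : R := (sqnorm x + e ^+ 2)^-1.

Lemma hweight_den_gt0 e (x : 'rV[R]_N) : 0 < e -> 0 < sqnorm x + e ^+ 2.
Proof. by move=> e0; rewrite ltr_wpDl ?sqnorm_ge0// exprn_gt0. Qed.

Lemma hweight_gt0 e (x : 'rV[R]_N) : 0 < e -> 0 < hweight e x.
Proof. by move=> e0; rewrite invr_gt0 hweight_den_gt0. Qed.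

Lemma smooth_hweight e : 0 < e -> smooth (hweight e).
Proof.
move=> e0.
rewrite (_ : hweight e = fun x => (sqnorm x + e ^+ 2) `^ (-1)).
  apply: smooth_powR => [|x]; last exact: hweight_den_gt0.
  exact: smoothD smooth_sqnorm (smooth_cst _).
by apply/funext => x; rewrite powR_inv1// ltW// hweight_den_gt0.
Qed.

Lemma is_derive_hweight e i x : 0 < e ->
  is_derive x (delta_mx 0 i) (hweight e) (- 2 * x 0 i * hweight e x ^+ 2).
Proof.
move=> e0; have dn : sqnorm x + e ^+ 2 != 0 by rewrite gt_eqF// hweight_den_gt0.
have dV : is_derive (sqnorm x + e ^+ 2) (1 : R) (fun y : R => y^-1)
   (- (sqnorm x + e ^+ 2) ^- 2 *: 1).
  by apply: (@is_deriveV _ (fun z => z)).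
have ds : is_derive x (delta_mx 0 i) (@sqnorm R N + cst (e ^+ 2)) (2 * x 0 i).
  rewrite -[X in is_derive _ _ _ X]addr0; apply: is_deriveD.
  exact: is_derive_sqnorm.
apply: (is_derive_eq (is_derive_comp_line dV ds)).
by rewrite [_ *: 1]mulr1 /hweight -exprVn; ring.
Qed.

Lemma smooth_continuous f : smooth f -> continuous f.
Proof. by move=> /smooth_C1[]. Qed.

(** With w the regularized weight, integrating the identity
      |grad phi + phi w x / 2|^2 =
        |grad phi|^2 + phi w (grad phi . x) + phi^2 w^2 |x|^2 / 4
    and removing the middle term by the divergence theorem for the field
    phi^2 w x (its components are the functions F i) gives the inequality with
    a constant at most 4, since N >= 3 and w |x|^2 <= 1. *)
Lemma hardy_test (e M : R) phi : (3 <= N)%N -> 0 < e -> smooth phi ->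
  (forall x, phi x != 0 -> `|x| <= M) ->
  (\int[lebesgue_rV N]_x (phi x ^+ 2 * hweight e x)%:E <=
   4%:E * \int[lebesgue_rV N]_x (sqnorm (grad phi x))%:E)%E.
Proof.
move=> N3 e0 sphi phiM.
pose F i := phi * phi * ((fun x : 'rV[R]_N => x 0 i) * hweight e).
have sF i : smooth (F i).
  exact: (smoothM (smoothM sphi sphi)
                  (smoothM (smooth_coord i) (smooth_hweight e0))).
have FM i x : F i x != 0 -> `|x| <= M.
  move=> Fx; apply: phiM; apply: contra_neq Fx => px0.
  by rewrite /F /= !fctE px0 !mul0r.
have dF i x : partial i (F i) x =
   2 * phi x * partial i phi x * x 0 i * hweight e x + phi x ^+ 2 * hweight e x
   - 2 * phi x ^+ 2 * x 0 i ^+ 2 * hweight e x ^+ 2.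
  have dphi := is_derive_partial ((smooth_C1 sphi).2 i x).
  rewrite (partial_is_derive (is_deriveM (is_deriveM dphi dphi)
     (is_deriveM (is_derive_coord i i x) (is_derive_hweight i x e0)))).
  by rewrite !fctE eqxx /GRing.scale/=; ring.
have pM i x : partial i phi x != 0 -> `|x| <= M by exact: partial_support.
have cg : continuous (fun x => sqnorm (grad phi x)).
  apply: smooth_continuous; apply: smooth_sum => i.
  rewrite (_ : (fun _ => _) = partial i phi * partial i phi).
    by apply: smoothM; exact: smooth_partial.
  by apply/funext => x; rewrite mxE.
have ig : (lebesgue_rV N).-integrable setT (fun x => (sqnorm (grad phi x))%:E).
  apply: (integrable_continuous_bounded_support (M := M)) => // x.
  apply: contraNT; rewrite -ltNge => Mx; rewrite /sqnorm big1// => i _.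
  rewrite mxE; apply/eqP; rewrite sqrf_eq0.
  by apply: contraLR Mx => /pM; rewrite -leNgt.
have iF i : (lebesgue_rV N).-integrable setT (fun x => (partial i (F i) x)%:E).
  apply: (integrable_continuous_bounded_support (M := M)).
    exact: smooth_continuous (smooth_partial _ (sF i)).
  by apply: partial_support => x; exact: FM.
have I0 : (\int[lebesgue_rV N]_x (\sum_i (partial i (F i) x)%:E) = 0)%E.
  rewrite integral_sum//; apply: big1 => i _.
  apply: (@integral_partial_eq0 _ _ _ _ M) => [x||].
  - exact: (smooth_C1 (sF i)).2.
  - exact: smooth_continuous (smooth_partial _ (sF i)).
  - exact: FM.
have cphi : continuous (fun x => phi x ^+ 2 * hweight e x).
  exact: smooth_continuous (smoothM (smoothM sphi sphi) (smooth_hweight e0)).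
apply: (@le_trans _ _ (\int[lebesgue_rV N]_x
   (4%:E * (sqnorm (grad phi x))%:E + 2%:E * (\sum_i (partial i (F i) x)%:E)))%E).
  apply: le_integral => //.
  - apply: (integrable_continuous_bounded_support (M := M)) => // x H.
    by apply: phiM; apply: contra_neq H => ->; rewrite expr0n/= mul0r.
  - apply: integrableD => //; apply: integrableZl => //.
    by apply: integrable_sum.
  - move=> x _; rewrite sumEFin -!EFinM -EFinD lee_fin.
    under eq_bigr do rewrite dF.
    rewrite !big_split/= sumrN.
    set p := phi x; set w := hweight e x.
    pose S := \sum_i partial i phi x * x 0 i.
    pose A := sqnorm (grad phi x).
    have -> : \sum_i 2 * p * partial i phi x * x 0 i * w = 2 * p * w * S.
      by rewrite /S mulr_sumr; apply: eq_bigr => i _; ring.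
    have -> : \sum_i 2 * p ^+ 2 * x 0 i ^+ 2 * w ^+ 2 =
        2 * p ^+ 2 * w ^+ 2 * sqnorm x.
      by rewrite /sqnorm mulr_sumr; apply: eq_bigr => i _; ring.
    rewrite sumr_const card_ord -[_ *+ N]mulr_natl -/A.
    have sq : 0 <= A + p * w * S + p ^+ 2 * w ^+ 2 * sqnorm x / 4.
      have <- : \sum_i (partial i phi x + p * w * x 0 i / 2) ^+ 2 =
          A + p * w * S + p ^+ 2 * w ^+ 2 * sqnorm x / 4.
        rewrite /A /S /sqnorm !mulr_sumr mulr_suml -!big_split/=.
        by apply: eq_bigr => i _; rewrite mxE; field.
      by apply: sumr_ge0 => i _; exact: sqr_ge0.
    have w0 : 0 < w by exact: hweight_gt0.
    have wq : w * sqnorm x <= 1.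
      rewrite /w /hweight mulrC ler_pdivrMr ?hweight_den_gt0// mul1r lerDl.
      exact: sqr_ge0.
    have N3' : 3 <= N%:R :> R by rewrite ler_nat.
    have : 0 <= p ^+ 2 * w * (2 * N%:R - 5 * (w * sqnorm x) - 1).
      apply: mulr_ge0; first by rewrite mulr_ge0 ?sqr_ge0 ?ltW.
      clear -wq N3'; lra.
    clearbody w; clear -sq; lra.
rewrite integralD//; last 2 first.
- exact: integrableZl.
- by apply: integrableZl => //; apply: integrable_sum.
rewrite !integralZl//; last by apply: integrable_sum.
by rewrite I0 mule0 adde0.
Qed.

End hardy.

(** * Fatou's lemma and almost everywhere convergence *)

Section fatou_ae.
Context d (T : measurableType d) (R : realType).
Variable mu : {measure set T -> \bar R}.
Variables (D : set T) (mD : measurable D).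
Local Open Scope ereal_scope.

Lemma fatou_ae_le (f : nat -> T -> \bar R) (g : T -> \bar R) (c : \bar R) :
  (forall n, measurable_fun D (f n)) -> measurable_fun D g ->
  (forall n x, D x -> 0 <= f n x) -> (forall x, D x -> 0 <= g x) ->
  {ae mu, forall x, D x -> f n x @[n --> \oo] --> g x} ->
  (forall n, \int[mu]_(x in D) f n x <= c) ->
  \int[mu]_(x in D) g x <= c.
Proof.
move=> mf mg f0 g0 [Z [mZ Z0 HZ]] fc.
have mDZ : measurable (D `\` Z) by exact: measurableD.
rewrite (ge0_negligible_integral mZ)//.
rewrite (eq_integral (fun x => limn_einf (f^~ x))); last first.
  move=> x /[!inE] -[Dx Zx].
  have fg : f n x @[n --> \oo] --> g x.
    by apply: contrapT => H; apply: Zx; apply: HZ => /(_ Dx).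
  rewrite is_cvg_limn_einfE; first by apply/esym/cvg_lim.
  by apply/cvg_ex; exists (g x).
have mfZ n : measurable_fun (D `\` Z) (f n).
  by apply: measurable_funS (mf n) => //; exact: subDsetl.
have f0Z n x : (D `\` Z) x -> 0 <= f n x by move=> [Dx _]; exact: f0.
apply: (le_trans (fatou mu mDZ mfZ f0Z)).
rewrite limn_einf_lim; apply: lime_le; first exact: is_cvg_einfs.
apply: nearW => n.
apply: (@le_trans _ _ (\int[mu]_(x in D `\` Z) f n x)).
  by apply: ereal_inf_lbound; exists n => //=.
apply: le_trans (fc n); apply: ge0_subset_integral => // x; exact: f0.
Qed.

Lemma emeasurable_lincomb (f g : T -> \bar R) (a b : R) :
  measurable_fun D f -> measurable_fun D g ->
  measurable_fun D (fun x => a%:E * f x + b%:E * g x).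
Proof. by move=> mf mg; apply: emeasurable_funD; apply: emeasurable_funM. Qed.

Lemma ge0_integral_lincomb (f g : T -> \bar R) (a b : R) :
  (0 <= a)%R -> (0 <= b)%R -> measurable_fun D f -> measurable_fun D g ->
  (forall x, D x -> 0 <= f x) -> (forall x, D x -> 0 <= g x) ->
  \int[mu]_(x in D) (a%:E * f x + b%:E * g x) =
  a%:E * \int[mu]_(x in D) f x + b%:E * \int[mu]_(x in D) g x.
Proof.
move=> a0 b0 mf mg f0 g0; rewrite -!ge0_integralZl// -ge0_integralD//.
- by move=> x Dx; rewrite mule_ge0// f0.
- exact: emeasurable_funM.
- by move=> x Dx; rewrite mule_ge0// g0.
- exact: emeasurable_funM.
Qed.

(** Choose the terms so that their integrals are summable: the series of the
    functions is then integrable, hence finite almost everywhere, and its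
    general term tends to 0 there. *)
Lemma ae_subsequence (n0 : nat) (f : nat -> T -> R) :
  (forall n, measurable_fun D (f n)) -> (forall n x, D x -> (0 <= f n x)%R) ->
  \int[mu]_(x in D) (f n x)%:E @[n --> \oo] --> 0 ->
  exists g : nat -> nat, (forall k, (n0 <= g k)%N) /\
    {ae mu, forall x, D x -> f (g k) x @[k --> \oo] --> (0 : R)%R}.
Proof.
move=> mf f0 cf.
have /choice[g Hg] : forall k, exists n, (n0 <= n)%N /\
    \int[mu]_(x in D) (f n x)%:E <= (1 / (2 ^ k.+1)%:R)%:E.
  move=> k.
  have e0 : (0 < 1 / (2 ^ k.+1)%:R :> R)%R by rewrite divr_gt0// ltr0n expn_gt0.
  have := cf; move/fine_cvgP => [finf /cvgrPdist_le /(_ _ e0) H].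
  have : \forall n \near \oo, (n0 <= n)%N by exact: nbhs_infty_ge.
  move=> kn; have := filterI (filterI finf H) kn => -[m _ Hm].
  have [[h1 h2] h3] := Hm m (leqnn m); exists m; split => //.
  rewrite -(fineK h1) lee_fin; move: h2; rewrite /= sub0r normrN.
  exact/le_trans/ler_norm.
exists g; split; first by move=> k; have [] := Hg k.
have mS : measurable_fun D (fun x => \sum_(0 <= k <oo) (f (g k) x)%:E).
  apply: ge0_emeasurable_sum => [k x Dx _|k _].
    by rewrite lee_fin f0.
  by apply/measurable_EFinP.
have : mu.-integrable D (fun x => \sum_(0 <= k <oo) (f (g k) x)%:E).
  apply/integrableP; split => //.
  rewrite (eq_integral (fun x => \sum_(0 <= k <oo) (f (g k) x)%:E)); last first.
    move=> x /[!inE] Dx; rewrite gee0_abs//.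
    by apply: nneseries_ge0 => k _ _; rewrite lee_fin f0.
  rewrite integral_nneseries//; last 2 first.
  - by move=> n; apply/measurable_EFinP.
  - by move=> n x Dx; rewrite lee_fin f0.
  apply: (@le_lt_trans _ _ (\sum_(0 <= k <oo) (1 / (2 ^ k.+1)%:R)%:E)).
    apply: lee_nneseries => k *; first last.
      exact: (Hg k).2.
    by apply: integral_ge0 => x Dx; rewrite lee_fin f0.
  exact: le_lt_trans (epsilon_trick0 _ ler01) (ltry _).
move=> /(integrable_ae mD); apply: filterS => x Hx Dx.
have := Hx Dx; rewrite ge0_fin_numE => [Sx|]; last first.
  by apply: nneseries_ge0 => k _ _; rewrite lee_fin f0.
have fx0 k : 0 <= (f (g k) x)%:E by rewrite lee_fin f0.
have tail := nneseries_tail_cvg Sx (fun k _ => fx0 k).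
suff : (f (g k) x)%:E @[k --> \oo] --> 0 by move=> /fine_cvgP[].
apply: (@squeeze_cvge _ _ _ _ (cst 0) _
  (fun k => \sum_(k <= j <oo) (f (g j) x)%:E)) => //; last exact: cvg_cst.
apply: nearW => k; rewrite fx0/=.
apply: le_trans (nneseries_lim_ge k.+1 _) => //.
by rewrite big_nat1.
Qed.

End fatou_ae.

(** * Test functions *)

Section test_functions.
Context {R : realType} {N : nat} (Omega : set 'rV[R]_N).
Implicit Types phi : 'rV[R]_N -> R.
Local Notation mu := (@lebesgue_rV R N).

Lemma Cc_smooth_smooth phi : Cc_smooth Omega phi -> smooth phi.
Proof. by case. Qed.

Lemma Cc_support phi : Cc_smooth Omega phi ->
  exists M, forall x, phi x != 0 -> `|x| <= M.
Proof.
move=> [_ /compact_bounded[M0 [_ HM]] _]; exists (M0 + 1) => x px.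
by apply: (HM (M0 + 1)); [rewrite ltrDl|exact: subset_closure].
Qed.

Lemma Cc_out phi x : Cc_smooth Omega phi -> ~ Omega x ->
  exists U : set 'rV[R]_N, [/\ open U, U x & forall y, U y -> phi y = 0].
Proof.
move=> [_ _ sub] Ox; exists (~` closure [set x | phi x != 0]); split.
- by apply: closed_openC; exact: closed_closure.
- by move=> /sub.
- move=> y yc; apply/eqP; apply: contrapT => /negP p0; apply: yc.
  exact: subset_closure.
Qed.

Lemma Cc_out0 phi x : Cc_smooth Omega phi -> ~ Omega x -> phi x = 0.
Proof. by move=> cphi Ox; have [U [_ Ux ->]] := Cc_out cphi Ox. Qed.

Lemma Cc_out_partial phi i x :
  Cc_smooth Omega phi -> ~ Omega x -> partial i phi x = 0.
Proof.
move=> cphi Ox; have [U [oU Ux U0]] := Cc_out cphi Ox.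
exact: (partial_eq0 _ oU).
Qed.

Lemma Cc_out_grad phi x :
  Cc_smooth Omega phi -> ~ Omega x -> sqnorm (grad phi x) = 0.
Proof.
move=> cphi Ox; rewrite /sqnorm big1// => i _.
by rewrite mxE Cc_out_partial// expr0n.
Qed.

Lemma Cc_bounded phi : Cc_smooth Omega phi ->
  exists K, 0 < K /\ forall x, `|phi x| <= K.
Proof.
move=> cphi; have [M HM] := Cc_support cphi.
have : compact (phi @` [set x : 'rV[R]_N | `|x| <= M]).
  apply: continuous_compact; last exact: compact_norm_le.
  apply: continuous_subspaceT.
  exact: smooth_continuous (Cc_smooth_smooth cphi).
move=> /compact_bounded[K0 [_ HK]].
exists (`|K0| + 1); split; first by rewrite ltr_wpDl.
move=> x; have [->|/HM xM] := eqVneq (phi x) 0; first by rewrite normr0 addr_ge0.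
apply: (HK (`|K0| + 1)); last by exists x.
by rewrite ltr_pwDr// ler_norm.
Qed.

Lemma measurable_smooth D phi : smooth phi ->
  measurable_fun D (phi : 'rV[R]_N -> measurableTypeR R).
Proof.
move=> sphi; apply: measurable_funTS.
exact: continuous_measurable_rV (smooth_continuous sphi).
Qed.

Lemma measurable_sqnorm D (g : 'rV[R]_N -> 'rV[R]_N) : measurable_fun D g ->
  measurable_fun D (fun x => sqnorm (g x) : measurableTypeR R).
Proof.
move=> mg; apply: measurable_sum => i.
apply: (@measurable_funX _ _ _ _ (fun x => g x 0 i : measurableTypeR R)).
by apply: (measurableT_comp (measurable_coord i)).
Qed.

Lemma measurable_grad D phi : smooth phi -> measurable_fun D (grad phi).
Proof.
move=> sphi; apply: measurable_funTS; apply: measurable_fun_rV => i.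
rewrite (_ : (fun _ => _) = partial i phi); last by apply/funext => x; rewrite mxE.
by apply: measurable_smooth; exact: smooth_partial.
Qed.

Lemma measurable_enorm D :
  measurable_fun D (@enorm R N : 'rV[R]_N -> measurableTypeR R).
Proof.
apply: (measurableT_comp (continuous_measurable_fun (@sqrt_continuous R))).
exact: measurable_sqnorm.
Qed.

Lemma measurable_powR_comp D (h : 'rV[R]_N -> R) (q : R) :
  measurable_fun D (h : 'rV[R]_N -> measurableTypeR R) ->
  measurable_fun D (fun x => h x `^ q : measurableTypeR R).
Proof. by move=> mh; apply: (measurableT_comp (measurable_powR q)). Qed.

Lemma measurable_sqnormV D :
  measurable_fun D (fun x : 'rV[R]_N => (sqnorm x)^-1 : measurableTypeR R).
Proof.
rewrite (_ : (fun _ => _) = (fun x => sqnorm x `^ (-1))).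
  by apply: measurable_powR_comp; exact: measurable_sqnorm.
by apply/funext => x; rewrite powR_inv1// sqnorm_ge0.
Qed.

Lemma measurable_enorm_powRV D (q : R) :
  measurable_fun D
    (fun x : 'rV[R]_N => (enorm x `^ q)^-1 : measurableTypeR R).
Proof.
under eq_fun do rewrite -powRN.
by apply: measurable_powR_comp; exact: measurable_enorm.
Qed.

Lemma integral_grad_setT phi : measurable Omega -> Cc_smooth Omega phi ->
  (\int[mu]_x (sqnorm (grad phi x))%:E = \int[mu]_(x in Omega) (sqnorm (grad phi x))%:E)%E.
Proof.
move=> mO cphi; rewrite [RHS]integral_mkcond; apply: eq_integral => x _.
rewrite patchE; case: ifPn => // /negP; rewrite inE => Ox.
by rewrite Cc_out_grad.
Qed.

Lemma integral_grad_fin phi : measurable Omega -> Cc_smooth Omega phi ->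
  (\int[mu]_(x in Omega) (sqnorm (grad phi x))%:E < +oo)%E.
Proof.
move=> mO cphi; rewrite -integral_grad_setT//.
have [M HM] := Cc_support cphi.
have sphi := Cc_smooth_smooth cphi.
have cg : continuous (fun x => sqnorm (grad phi x)).
  apply: smooth_continuous; apply: smooth_sum => i.
  rewrite (_ : (fun _ => _) = partial i phi * partial i phi).
    by apply: smoothM; exact: smooth_partial.
  by apply/funext => x; rewrite mxE.
have : mu.-integrable setT (EFin \o (fun x => sqnorm (grad phi x))).
  apply: (integrable_continuous_bounded_support (M := M)) => // x.
  apply: contraNT; rewrite -ltNge => Mx; rewrite /sqnorm big1// => i _.
  rewrite mxE; apply/eqP; rewrite sqrf_eq0.
  by apply: contraLR Mx => /(partial_support HM); rewrite -leNgt.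
move=> /integrableP[_]; apply: le_lt_trans.
apply: ge0_le_integral => //.
- by move=> x _; rewrite lee_fin sqnorm_ge0.
- by apply/measurable_EFinP; apply: measurable_sqnorm; exact: measurable_grad.
- apply/measurable_EFinP; apply: measurableT_comp => //.
  by apply: measurable_sqnorm; exact: measurable_grad.
- by move=> x _ /=; rewrite lee_fin ler_norm.
Qed.

Lemma test_D12 phi : (3 <= N)%N -> open Omega -> Cc_smooth Omega phi ->
  exists U : D12_0 Omega, D12_fun U = phi /\ D12_grad U = grad phi.
Proof.
move=> N3 oO cphi; have sphi := Cc_smooth_smooth cphi.
have p0 : twostar N (0 : R) != 0.
  rewrite /twostar subr0; have N3' : 3 <= N%:R :> R by rewrite ler_nat.
  by rewrite gt_eqF// divr_gt0//; lra.
have Happ : exists phi0 : nat -> 'rV[R]_N -> R,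
    [/\ forall n, Cc_smooth Omega (phi0 n),
        (\int[mu]_(x in Omega)
           (`|phi0 n x - phi x| `^ twostar N 0)%:E)%E @[n --> \oo] --> 0%E
      & (\int[mu]_(x in Omega)
           (enorm (grad (phi0 n) x - grad phi x) ^+ 2)%:E)%E @[n --> \oo]
          --> 0%E].
  exists (fun=> phi); split => //.
  - rewrite integral0_eq; first exact: cvg_cst.
    by move=> x _; rewrite subrr normr0 powR0.
  - rewrite integral0_eq; first exact: cvg_cst.
    move=> x _; rewrite enorm2 subrr /sqnorm big1// => i _.
    by rewrite mxE expr0n.
by exists (Build_D12_0 (@measurable_smooth Omega phi sphi)
  (@measurable_grad Omega phi sphi) Happ).
Qed.

End test_functions.

(** * Energy and almost everywhere approximation in the space D12_0 *)

Section dirichlet.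
Context {R : realType} {N : nat} (Omega : set 'rV[R]_N).
Hypotheses (oO : open Omega).
Local Notation mu := (@lebesgue_rV R N).
Implicit Types u v : D12_0 Omega.

Let mO : measurable Omega := open_measurable_rV oO.

Lemma sqnorm_young (a b : 'rV[R]_N) (d : R) : 0 < d ->
  sqnorm a <= (1 + d) * sqnorm b + (1 + d^-1) * sqnorm (a - b).
Proof.
move=> d0; rewrite /sqnorm !mulr_sumr -big_split/=; apply: ler_sum => i _.
rewrite !mxE; set x := a 0 i; set y := b 0 i.
rewrite -subr_ge0.
have -> : (1 + d) * y ^+ 2 + (1 + d^-1) * (x - y) ^+ 2 - x ^+ 2 =
  d^-1 * (d * y - (x - y)) ^+ 2 by field; rewrite gt_eqF.
by rewrite mulr_ge0 ?sqr_ge0// invr_ge0 ltW.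
Qed.

Definition dirichlet u : \bar R :=
  (\int[mu]_(x in Omega) (sqnorm (D12_grad u x))%:E)%E.

Lemma dirichlet_ge0 u : (0 <= dirichlet u)%E.
Proof. by apply: integral_ge0 => x _; rewrite lee_fin sqnorm_ge0. Qed.

Lemma measurable_sqnormE (g : 'rV[R]_N -> 'rV[R]_N) : measurable_fun Omega g ->
  measurable_fun Omega (fun x => (sqnorm (g x))%:E).
Proof. by move=> mg; apply/measurable_EFinP; exact: measurable_sqnorm. Qed.

Lemma measurable_sqnormB (g h : 'rV[R]_N -> 'rV[R]_N) :
  measurable_fun Omega g -> measurable_fun Omega h ->
  measurable_fun Omega (fun x => (sqnorm (g x - h x))%:E).
Proof.
move=> mg mh; apply/measurable_EFinP; apply: measurable_sum => i.
under eq_fun do rewrite mxE [X in _ + X]mxE.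
apply: measurable_funX; apply: measurable_funB.
  exact: (measurableT_comp (measurable_coord i) mg).
exact: (measurableT_comp (measurable_coord i) mh).
Qed.

Lemma integral_sqnorm_young (g h : 'rV[R]_N -> 'rV[R]_N) (d : R) : 0 < d ->
  measurable_fun Omega g -> measurable_fun Omega h ->
  (\int[mu]_(x in Omega) (sqnorm (g x))%:E <=
    (1 + d)%:E * \int[mu]_(x in Omega) (sqnorm (h x))%:E +
    (1 + d^-1)%:E * \int[mu]_(x in Omega) (sqnorm (g x - h x))%:E)%E.
Proof.
move=> d0 mg mh; have mgh := measurable_sqnormB mg mh.
have d1 : 0 <= 1 + d by rewrite addr_ge0// ltW.
have d2 : 0 <= 1 + d^-1 by rewrite addr_ge0// invr_ge0 ltW.
have mhE := measurable_sqnormE mh.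
have n0 (f : 'rV[R]_N -> 'rV[R]_N) x : Omega x -> (0 <= (sqnorm (f x))%:E)%E.
  by move=> _; rewrite lee_fin sqnorm_ge0.
rewrite -(ge0_integral_lincomb _ mO d1 d2 mhE mgh (n0 h) (n0 (fun x => g x - h x))).
apply: ge0_le_integral => //.
- exact: n0.
- exact: measurable_sqnormE.
- exact: (emeasurable_lincomb _ _ mhE mgh).
- by move=> x _; rewrite -!EFinM -EFinD lee_fin sqnorm_young.
Qed.

End dirichlet.

Section D12_facts.
Context {R : realType} {N : nat} (Omega : set 'rV[R]_N).
Hypotheses (N3 : (3 <= N)%N) (oO : open Omega).
Local Notation mu := (@lebesgue_rV R N).
Implicit Types u v : D12_0 Omega.

Let mO : measurable Omega := open_measurable_rV oO.

Lemma cvg_ereal0_near (a : nat -> \bar R) (e : R) : 0 < e ->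
  a n @[n --> \oo] --> 0%E -> \forall n \near \oo, (a n <= e%:E)%E.
Proof.
move=> e0 /fine_cvgP[fin /cvgrPdist_le/(_ _ e0) H].
near=> n; rewrite -(@fineK _ (a n)) ?lee_fin; last by near: n.
have : `|0 - (fine \o a) n| <= e by near: n.
by rewrite /= sub0r normrN; exact/le_trans/ler_norm.
Unshelve. all: by end_near. Qed.

Lemma dirichlet_fin u : (dirichlet u < +oo)%E.
Proof.
have [phi [cphi _ H]] := D12_approx u.
have [n0 _ Hn] := cvg_ereal0_near (@ltr01 R) H.
have mg := D12_measurable_grad u.
have mp := @measurable_grad R N Omega _ (Cc_smooth_smooth (cphi n0)).
have sqnormC (a b : 'rV[R]_N) : sqnorm (a - b) = sqnorm (b - a).
  by apply: eq_bigr => i _; rewrite !mxE -sqrrN opprB.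
apply: le_lt_trans (integral_sqnorm_young oO ltr01 mg mp) _.
apply: lte_add_pinfty; apply: lte_mul_pinfty => //.
- exact: integral_grad_fin.
- have := Hn n0 (leqnn _).
  under eq_integral do rewrite enorm2 sqnormC.
  by move=> /le_lt_trans; apply; exact: ltry.
Qed.

Lemma dirichlet_approx u (phi : nat -> 'rV[R]_N -> R) (d : R) : 0 < d ->
  (forall n, Cc_smooth Omega (phi n)) ->
  (\int[mu]_(x in Omega)
    (enorm (grad (phi n) x - D12_grad u x) ^+ 2)%:E)%E @[n --> \oo] --> 0%E ->
  \forall n \near \oo,
    (\int[mu]_(x in Omega) (sqnorm (grad (phi n) x))%:E <= dirichlet u + d%:E)%E.
Proof.
move=> d0 cphi cv.
have mg := D12_measurable_grad u.
have [E EE] : exists E : R, dirichlet u = E%:E.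
  exists (fine (dirichlet u)); rewrite fineK// ge0_fin_numE ?dirichlet_fin//.
  exact: dirichlet_ge0.
have E0 : 0 <= E by rewrite -lee_fin -EE dirichlet_ge0.
(* sqnorm_young is applied with this parameter: h E <= d / 2, and the error term
   is at most d / 2 once the gradients are close enough *)
pose h := d / (2 * (E + 1)).
have h0 : 0 < h by rewrite divr_gt0// mulr_gt0//; lra.
have h1 : 0 < 1 + h^-1 by rewrite addr_gt0// invr_gt0.
have e0 : 0 < d / 2 / (1 + h^-1) by rewrite !divr_gt0.
near=> n.
have mp := @measurable_grad R N Omega _ (Cc_smooth_smooth (cphi n)).
apply: le_trans (integral_sqnorm_young oO h0 mp mg) _.
rewrite -/(dirichlet u) EE.
apply: (@le_trans _ _
  ((1 + h)%:E * E%:E + (1 + h^-1)%:E * (d / 2 / (1 + h^-1))%:E)%E).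
  apply: leeD => //; apply: lee_wpmul2l; first by rewrite lee_fin ltW.
  under eq_integral do rewrite -enorm2.
  by near: n; exact: cvg_ereal0_near.
rewrite -!EFinM -!EFinD lee_fin.
rewrite [_ * (_ / _ / _)]mulrC divfK ?gt_eqF//.
have : h * E <= d / 2.
  rewrite /h mulrAC ler_pdivrMr ?mulr_gt0//; last by lra.
  by nra.
lra.
Unshelve. all: by end_near. Qed.

Lemma cvg_powR0 (p : R) (a : nat -> R) : 0 < p ->
  `|a n| `^ p @[n --> \oo] --> (0 : R) -> a n @[n --> \oo] --> (0 : R).
Proof.
move=> p0 ca; apply/cvgrPdist_lt => e e0.
have ep : 0 < e `^ p by exact: powR_gt0.
near=> n; rewrite sub0r normrN.
have : `|0 - `|a n| `^ p| < e `^ p.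
  near: n; exact: (cvgrPdist_lt _ _).1.
rewrite sub0r normrN ger0_norm ?powR_ge0//.
apply: contraTT; rewrite -!leNgt => ea.
by rewrite ge0_ler_powR ?nnegrE// ?(ltW p0)// (ltW e0).
Unshelve. all: by end_near. Qed.

Lemma twostar0_gt0 : 0 < twostar N (0 : R).
Proof.
rewrite /twostar subr0; have N3' : 3 <= N%:R :> R by rewrite ler_nat.
by rewrite divr_gt0//; lra.
Qed.

Lemma measurable_powR_norm D (f : 'rV[R]_N -> R) (p : R) :
  measurable_fun D (f : 'rV[R]_N -> measurableTypeR R) ->
  measurable_fun D (fun x => `|f x| `^ p : measurableTypeR R).
Proof.
move=> mf; apply: measurable_powR_comp; exact: measurableT_comp mf.
Qed.

Lemma D12_approx_ae u v (d : R) : 0 < d ->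
  exists phi chi : nat -> 'rV[R]_N -> R,
  [/\ forall n, Cc_smooth Omega (phi n), forall n, Cc_smooth Omega (chi n),
      forall n, (\int[mu]_(x in Omega) (sqnorm (grad (phi n) x))%:E
                 <= dirichlet u + d%:E)%E,
      forall n, (\int[mu]_(x in Omega) (sqnorm (grad (chi n) x))%:E
                 <= dirichlet v + d%:E)%E &
      {ae mu, forall x, Omega x ->
        phi n x @[n --> \oo] --> u x /\ chi n x @[n --> \oo] --> v x}].
Proof.
move=> d0.
have [phi [cphi phi1 phi2]] := D12_approx u.
have [chi [cchi chi1 chi2]] := D12_approx v.
have [n0 _ Hn0] := filterI (dirichlet_approx d0 cphi phi2)
  (dirichlet_approx d0 cchi chi2).
pose p := twostar N (0 : R).
pose f n x := `|phi n x - u x| `^ p + `|chi n x - v x| `^ p.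
have m1 (w : D12_0 Omega) psi : Cc_smooth Omega psi ->
    measurable_fun Omega (fun x => `|psi x - w x| `^ p : measurableTypeR R).
  move=> cpsi; apply: measurable_powR_norm; apply: measurable_funB.
    by apply: measurable_smooth; exact: Cc_smooth_smooth cpsi.
  exact: D12_measurable_fun.
have [|||g [g0 gae]] := @ae_subsequence _ _ _ mu Omega mO n0 f.
- by move=> n; apply: measurable_funD; exact: m1.
- by move=> n x _; rewrite addr_ge0// powR_ge0.
- rewrite (_ : (fun n => _) = (fun n =>
    (\int[mu]_(x in Omega) (`|phi n x - u x| `^ p)%:E +
     \int[mu]_(x in Omega) (`|chi n x - v x| `^ p)%:E)%E)); last first.
    apply/funext => n; rewrite -ge0_integralD//.
    + by apply/measurable_EFinP; exact: m1.
    + by apply/measurable_EFinP; exact: m1.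
  have := cvgeD _ phi1 chi1; rewrite adde0; exact.
exists (fun k => phi (g k)), (fun k => chi (g k)); split => //.
- by move=> k; exact: (Hn0 (g k) (g0 k)).1.
- by move=> k; exact: (Hn0 (g k) (g0 k)).2.
apply: filterS gae => x Hx Ox; have {}Hx := Hx Ox.
have sub0 (a : nat -> R) (l : R) : (forall k, `|a k - l| `^ p <= f (g k) x) ->
    a k @[k --> \oo] --> l.
  move=> af; apply/subr_cvg0; apply: (cvg_powR0 twostar0_gt0).
  apply: (@squeeze_cvgr _ _ _ _ (cst 0) (fun k => f (g k) x)) => //;
    last exact: cvg_cst.
  by apply: nearW => k; rewrite powR_ge0 af.
by split; apply: sub0 => k; rewrite /f ?lerDl ?lerDr powR_ge0.
Qed.

Lemma D12_hardy_reg u (e : R) : 0 < e ->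
  (\int[mu]_(x in Omega) (u x ^+ 2 * hweight e x)%:E <= 4%:E * dirichlet u)%E.
Proof.
move=> e0; apply/lee_addgt0Pr => d d0.
have d4 : 0 < d / 4 by rewrite divr_gt0.
have [phi [chi [cphi _ phiE _ phiae]]] := D12_approx_ae u u d4.
have mweight D : measurable_fun D (hweight e : 'rV[R]_N -> measurableTypeR R).
  by apply: measurable_smooth; exact: smooth_hweight.
apply: (@fatou_ae_le _ _ _ mu Omega mO (fun n x => (phi n x ^+ 2 * hweight e x)%:E)).
- move=> n; apply/measurable_EFinP; apply: measurable_funM; last exact: mweight.
  apply: measurable_funX; apply: measurable_smooth.
  exact: Cc_smooth_smooth (cphi n).
- apply/measurable_EFinP; apply: measurable_funM; last exact: mweight.
  apply: measurable_funX; exact: D12_measurable_fun.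
- by move=> n x _; rewrite lee_fin mulr_ge0 ?sqr_ge0// ltW// hweight_gt0.
- by move=> x _; rewrite lee_fin mulr_ge0 ?sqr_ge0// ltW// hweight_gt0.
- apply: filterS phiae => x Hx Ox; have [{}Hx _] := Hx Ox.
  apply: cvg_EFin; first by apply: nearW.
  exact: (cvgM (cvgM Hx Hx) (cvg_cst _)).
- move=> n; have [M HM] := Cc_support (cphi n).
  apply: (@le_trans _ _ (\int[mu]_x (phi n x ^+ 2 * hweight e x)%:E)%E).
    apply: ge0_subset_integral => //.
    + apply/measurable_EFinP; apply: measurable_funM; last exact: mweight.
      apply: measurable_funX; apply: measurable_smooth.
      exact: Cc_smooth_smooth (cphi n).
    + by move=> x _; rewrite lee_fin mulr_ge0 ?sqr_ge0// ltW// hweight_gt0.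
  apply: le_trans (hardy_test N3 e0 (Cc_smooth_smooth (cphi n)) HM) _.
  rewrite (integral_grad_setT mO (cphi n)).
  apply: (@le_trans _ _ (4%:E * (dirichlet u + (d / 4)%:E))%E).
    by apply: lee_wpmul2l; rewrite ?lee_fin.
  rewrite muleDr ?ge0_adde_def ?inE ?dirichlet_ge0 ?lee_fin ?(ltW d4)//.
  by rewrite -EFinM mulrC divfK.
Qed.

Lemma ae_neq0 : {ae mu, forall x : 'rV[R]_N, x != 0}.
Proof.
exists [set 0]; split; first exact: measurable_rV_set1.
- by apply: lebesgue_rV_set1_0; case: (N) N3.
- by move=> x /= /negP; rewrite negbK => /eqP.
Qed.

Lemma sqnorm_gt0 (x : 'rV[R]_N) : x != 0 -> 0 < sqnorm x.
Proof.
move=> x0; rewrite lt_neqAle sqnorm_ge0 andbT eq_sym; apply: contraNN x0.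
rewrite psumr_eq0 => [/allP H|i _]; last exact: sqr_ge0.
apply/eqP/rowP => i; rewrite mxE; apply/eqP.
by rewrite -sqrf_eq0; apply: H; rewrite mem_index_enum.
Qed.

(** Let the regularization of the weight tend to 0. At x = 0, where the
    quotient is 0 by convention, the integrands need not converge, but a point
    is negligible. *)
Lemma D12_hardy u :
  (\int[mu]_(x in Omega) (u x ^+ 2 / sqnorm x)%:E <= 4%:E * dirichlet u)%E.
Proof.
pose e n : R := n.+1%:R^-1.
have e0 n : 0 < e n by rewrite invr_gt0.
have mweight n D : measurable_fun D (hweight (e n) : 'rV[R]_N -> measurableTypeR R).
  by apply: measurable_smooth; exact: smooth_hweight.
apply: (@fatou_ae_le _ _ _ mu Omega mO (fun n x => (u x ^+ 2 * hweight (e n) x)%:E)).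
- move=> n; apply/measurable_EFinP; apply: measurable_funM; last exact: mweight.
  apply: measurable_funX; exact: D12_measurable_fun.
- apply/measurable_EFinP; apply: measurable_funM.
    apply: measurable_funX; exact: D12_measurable_fun.
  exact: measurable_sqnormV.
- by move=> n x _; rewrite lee_fin mulr_ge0 ?sqr_ge0// ltW// hweight_gt0.
- by move=> x _; rewrite lee_fin mulr_ge0 ?sqr_ge0// invr_ge0 sqnorm_ge0.
- apply: filterS ae_neq0 => x x0 _.
  apply: cvg_EFin; first by apply: nearW.
  apply: cvgM; first exact: cvg_cst.
  apply: cvgV; first by rewrite gt_eqF// sqnorm_gt0.
  rewrite -[X in _ --> X]addr0; apply: cvgD; first exact: cvg_cst.
  rewrite -[X in _ --> X](mulr0 (0 : R)).
  exact: (cvgM (@cvg_harmonic R) (@cvg_harmonic R)).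
- by move=> n; exact: D12_hardy_reg.
Qed.

End D12_facts.

(** * The coupling integrand *)

Section density.
Context {R : realType} {N : nat}.
Variables (s lambda mu kappa alpha beta : R).
Hypotheses (N3 : (3 <= N)%N) (s0 : 0 < s) (s2 : s < 2) (l0 : 0 < lambda)
  (m0 : 0 < mu) (k0 : 0 < kappa) (a1 : 1 < alpha) (b1 : 1 < beta)
  (ab : alpha + beta = twostar N s).

Local Notation p := (twostar N s).

Definition density (x : 'rV[R]_N) (a b : R) : R :=
  lambda * (a `^ p / enorm x `^ s) + mu * (b `^ p / enorm x `^ s)
  + p * kappa * (a `^ alpha * b `^ beta / enorm x `^ s).

Let N3' : 3 <= N%:R :> R.
Proof. by rewrite ler_nat. Qed.

Lemma twostar_gt2 : 2 < p.
Proof.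
have N3r := N3'; have s2r := s2.
rewrite /twostar ltr_pdivlMr; last by lra.
lra.
Qed.

Lemma density_ge0 x a b : 0 <= density x a b.
Proof.
have p0 : 0 <= p by apply: ltW; have := twostar_gt2; lra.
have r0 : 0 <= (enorm x `^ s)^-1 by rewrite invr_ge0 powR_ge0.
have l0' := ltW l0; have m0' := ltW m0; have k0' := ltW k0.
rewrite /density; apply: addr_ge0; first apply: addr_ge0.
- by apply: mulr_ge0 => //; apply: mulr_ge0; rewrite ?powR_ge0.
- by apply: mulr_ge0 => //; apply: mulr_ge0; rewrite ?powR_ge0.
- apply: mulr_ge0; first exact: mulr_ge0.
  by apply: mulr_ge0 => //; apply: mulr_ge0; exact: powR_ge0.
Qed.

Lemma density_scale (t : R) x a b : 0 < t ->
  density (t *: x) a b = (t `^ s)^-1 * density x a b.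
Proof.
move=> t0; rewrite /density; have -> : enorm (t *: x) = t * enorm x.
  rewrite /enorm (_ : \sum_i _ = t ^+ 2 * \sum_i x 0 i ^+ 2).
    by rewrite sqrtrM ?sqr_ge0// sqrtr_sqr gtr0_norm.
  by rewrite mulr_sumr; apply: eq_bigr => i _; rewrite mxE exprMn.
by rewrite powRM ?(ltW t0) ?sqrtr_ge0// invfM; ring.
Qed.

(** A lower bound for the derivative in t of density x (a + t) (b + t), up to
    the factor p. *)
Definition gain (x : 'rV[R]_N) (a b : R) : R :=
  (lambda * a `^ (p - 1) + mu * b `^ (p - 1)) / enorm x `^ s.

Lemma gain_ge0 x a b : 0 <= gain x a b.
Proof.
by rewrite /gain divr_ge0 ?addr_ge0 ?mulr_ge0 ?powR_ge0 ?(ltW l0) ?(ltW m0).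
Qed.

(** The term (y + t)^p = (y + t) (y + t)^(p - 1) is at least
    (y + t) y^(p - 1), and the mixed term is nondecreasing. *)
Lemma density_gain x (a b t : R) : 0 <= a -> 0 <= b -> 0 <= t ->
  density x a b + t * gain x a b <= density x (a + t) (b + t).
Proof.
move=> a0 b0 t0; have p2 := twostar_gt2.
set r := (enorm x `^ s)^-1.
have r0 : 0 <= r by rewrite invr_ge0 powR_ge0.
have step (y : R) : 0 <= y -> y `^ p + t * y `^ (p - 1) <= (y + t) `^ p.
  move=> y0; rewrite -[in leRHS](@mulr_powRB1 _ (y + t) p) ?addr_ge0//; last by lra.
  rewrite -[X in X + _ <= _](@mulr_powRB1 _ y p)//; last by lra.
  rewrite -mulrDl; apply: ler_wpM2l; first by rewrite addr_ge0.
  by rewrite ge0_ler_powR ?nnegrE ?lerDl ?(addr_ge0 y0)//; lra.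
have mono (y q : R) : 0 <= y -> 0 <= q -> y `^ q <= (y + t) `^ q.
  by move=> y0 q0; rewrite ge0_ler_powR ?nnegrE ?lerDl ?(addr_ge0 y0).
have cross : a `^ alpha * b `^ beta <= (a + t) `^ alpha * (b + t) `^ beta.
  by apply: ler_pM; rewrite ?powR_ge0//; apply: mono => //; have := a1; have := b1; lra.
have pk : 0 <= p * kappa by rewrite mulr_ge0// ?(ltW k0)//; have := twostar_gt2; lra.
rewrite /density /gain -/r.
have h1 := ler_wpM2r r0 (ler_wpM2l (ltW l0) (step a a0)).
have h2 := ler_wpM2r r0 (ler_wpM2l (ltW m0) (step b b0)).
have h3 := ler_wpM2l pk (ler_wpM2r r0 cross).
rewrite -/p in h1 h2 h3 *.
lra.
Qed.

(** The left side is X^(s/2) Y^(1 - s/2) with X = a^2 / |x|^2 and Y the power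
    of a with the critical exponent, hence at most max(X, Y). *)
Lemma hardy_sobolev_pt (x : 'rV[R]_N) (a : R) : 0 <= a ->
  a `^ p / enorm x `^ s <= a ^+ 2 / sqnorm x + a `^ twostar N 0.
Proof.
move=> a0; rewrite -enorm2; set r := enorm x.
have r0 : 0 <= r by exact: sqrtr_ge0.
have Y0 : 0 <= a `^ twostar N 0 by exact: powR_ge0.
have X0 : 0 <= a ^+ 2 / r ^+ 2 by rewrite divr_ge0// sqr_ge0.
have [->|rn] := eqVneq r 0.
  by rewrite powR0 ?gt_eqF// invr0 mulr0 addr_ge0// mulr_ge0// ?sqr_ge0//
             expr0n invr0.
have rp : 0 < r by rewrite lt_neqAle eq_sym rn.
have [az|an] := eqVneq a 0.
  rewrite {1}az powR0 ?mul0r ?addr_ge0//.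
  by rewrite gt_eqF//; have := twostar_gt2; lra.
have ap : 0 < a by rewrite lt_neqAle eq_sym an.
pose M := a ^+ 2 / r ^+ 2 + a `^ twostar N 0.
have M0 : 0 < M.
  by apply: ltr_pwDl => //; rewrite divr_gt0// exprn_gt0.
have -> : a `^ p / r `^ s =
    (a ^+ 2 / r ^+ 2) `^ (s / 2) * (a `^ twostar N 0) `^ (1 - s / 2).
  rewrite powRM ?sqr_ge0 ?invr_ge0// ?sqr_ge0//.
  rewrite -!powR_mulrn// -powRN -!powRrM.
  rewrite mulrAC -powRD; last by rewrite an implybT.
  rewrite -[(r `^ 2)^-1]powRN -powRrM; congr (_ `^ _ * _ `^ _); last by field.
  by rewrite /twostar; field; rewrite gt_eqF//; have := N3'; lra.
apply: (@le_trans _ _ (M `^ (s / 2) * M `^ (1 - s / 2))).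
  have mono (X q : R) : 0 <= X -> X <= M -> 0 <= q -> X `^ q <= M `^ q.
    by move=> X1 XM q0; rewrite ge0_ler_powR ?nnegrE// (ltW M0).
  have s0' := s0; have s2' := s2.
  by apply: ler_pM; rewrite ?powR_ge0//; apply: mono; rewrite ?lerDl ?lerDr//; lra.
rewrite -powRD; last by apply/implyP => _; rewrite gt_eqF.
by rewrite addrC subrK powRr1// ltW.
Qed.

Lemma powR_cross (a b e f : R) : 0 <= a -> 0 <= b -> 0 < e -> 0 < f ->
  a `^ e * b `^ f <= a `^ (e + f) + b `^ (e + f).
Proof.
move=> a0 b0 e0 f0; wlog : a b e f a0 b0 e0 f0 / a <= b.
  move=> H; have [ab'|/ltW ba] := leP a b; first exact: H.
  by rewrite mulrC [leRHS]addrC [e + f]addrC; apply: H.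
move=> le_ab; apply: (@le_trans _ _ (b `^ (e + f))); last by rewrite lerDr powR_ge0.
rewrite powRD; last by rewrite gt_eqF// addr_gt0.
apply: ler_wpM2r; rewrite ?powR_ge0//.
by rewrite ge0_ler_powR ?nnegrE ?(ltW e0).
Qed.

Lemma density_le x (a b : R) : 0 <= a -> 0 <= b ->
  density x a b <= (lambda + mu + p * kappa) *
    (a ^+ 2 / sqnorm x + a `^ twostar N 0 + (b ^+ 2 / sqnorm x + b `^ twostar N 0)).
Proof.
move=> a0 b0; have p2 := twostar_gt2.
have ha := hardy_sobolev_pt x a0; have hb := hardy_sobolev_pt x b0.
have hc := powR_cross a0 b0 (lt_trans ltr01 a1) (lt_trans ltr01 b1).
rewrite ab in hc.
have r0 : 0 <= (enorm x `^ s)^-1 by rewrite invr_ge0 powR_ge0.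
have A0 : 0 <= a `^ p / enorm x `^ s by rewrite divr_ge0 ?powR_ge0.
have B0 : 0 <= b `^ p / enorm x `^ s by rewrite divr_ge0 ?powR_ge0.
have hc' := ler_wpM2r r0 hc.
rewrite mulrDl in hc'.
have pk : 0 <= p * kappa by rewrite mulr_ge0// ?(ltW k0)//; have := twostar_gt2; lra.
rewrite /density.
set A := a `^ p / _ in ha hc' A0 *.
set B := b `^ p / _ in hb hc' B0 *.
set C := _ * _ / _ in hc' *.
set X := _ + _ in ha *.
set Y := b ^+ 2 / _ + _ in hb *.
rewrite !mulrDl; apply: lerD; first apply: lerD.
- by apply: ler_wpM2l; rewrite ?(ltW l0)//; lra.
- by apply: ler_wpM2l; rewrite ?(ltW m0)//; lra.
- by apply: ler_wpM2l => //; lra.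
Qed.

Lemma measurable_density (D : set 'rV[R]_N) (f g : 'rV[R]_N -> R) :
  measurable_fun D (f : 'rV[R]_N -> measurableTypeR R) ->
  measurable_fun D (g : 'rV[R]_N -> measurableTypeR R) ->
  measurable_fun D (fun x => density x (f x) (g x) : measurableTypeR R).
Proof.
move=> mf mg.
have mr := @measurable_enorm_powRV R N D s.
have mp := @measurable_powR_comp R N D.
apply: measurable_funD; first apply: measurable_funD.
- by apply: measurable_funM => //; apply: measurable_funM => //; exact: mp.
- by apply: measurable_funM => //; apply: measurable_funM => //; exact: mp.
- apply: measurable_funM => //; apply: measurable_funM => //.
  by apply: measurable_funM; exact: mp.
Qed.

Lemma measurable_gain (D : set 'rV[R]_N) (f g : 'rV[R]_N -> R) :
  measurable_fun D (f : 'rV[R]_N -> measurableTypeR R) ->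
  measurable_fun D (g : 'rV[R]_N -> measurableTypeR R) ->
  measurable_fun D (fun x => gain x (f x) (g x) : measurableTypeR R).
Proof.
move=> mf mg.
apply: measurable_funM; last exact: measurable_enorm_powRV.
apply: measurable_funD; apply: measurable_funM => //;
  exact: measurable_powR_comp.
Qed.

(** * Finiteness and positivity of the coupling and of the energy *)

Variable Omega : set 'rV[R]_N.
Hypotheses (oO : open Omega) (bO : bounded_set Omega).
Local Notation Leb := (@lebesgue_rV R N).
Implicit Types u v : D12_0 Omega.
Let mO : measurable Omega := open_measurable_rV oO.

Let mD12n u : measurable_fun Omega (fun x => `|u x| : measurableTypeR R).
Proof. by apply: measurableT_comp => //; exact: D12_measurable_fun. Qed.

(** A test function is bounded, hence integrable to any power on the bounded
    set Omega, and u is close to one in the sense of the same power. *)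
Lemma D12_Lcrit u : (\int[Leb]_(x in Omega) (`|u x| `^ twostar N 0)%:E < +oo)%E.
Proof.
have [phi [cphi H _]] := D12_approx u.
have [n0 _ Hn] := cvg_ereal0_near (@ltr01 R) H.
have [K [K0 HK]] := Cc_bounded (cphi n0).
set q := twostar N (0 : R) in H Hn *.
have q0 : 0 < q by exact: twostar0_gt0.
have mphi : measurable_fun Omega (phi n0 : _ -> measurableTypeR R).
  by apply: measurable_smooth; exact: Cc_smooth_smooth (cphi n0).
have mu1 : measurable_fun Omega
    (fun x => `|phi n0 x - u x| `^ q : measurableTypeR R).
  apply: measurable_powR_norm; apply: measurable_funB => //.
  exact: D12_measurable_fun.
have pt x : `|u x| `^ q <= (2 * K) `^ q + 2 `^ q * `|phi n0 x - u x| `^ q.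
  have [le|/ltW ge] := leP `|u x| (2 * K).
    apply: (@le_trans _ _ ((2 * K) `^ q));
      last by rewrite lerDl mulr_ge0 ?powR_ge0.
    by rewrite ge0_ler_powR ?nnegrE ?(ltW q0) ?mulr_ge0// ltW.
  apply: (@le_trans _ _ (2 `^ q * `|phi n0 x - u x| `^ q));
    last by rewrite lerDr powR_ge0.
  rewrite -powRM// ge0_ler_powR ?nnegrE ?(ltW q0) ?mulr_ge0//.
  have := HK x; have := ler_distD (phi n0 x) (u x) 0.
  by rewrite !subr0 distrC; lra.
apply: (@le_lt_trans _ _ (\int[Leb]_(x in Omega)
   (((2 * K) `^ q)%:E + (2 `^ q)%:E * (`|phi n0 x - u x| `^ q)%:E))%E).
  apply: ge0_le_integral => //.
  - apply/measurable_EFinP; apply: measurable_powR_norm.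
    exact: D12_measurable_fun.
  - apply: emeasurable_funD => //; apply: emeasurable_funM => //.
    exact/measurable_EFinP.
  - by move=> x _; rewrite -EFinM -EFinD lee_fin.
rewrite ge0_integralD//; first last.
- by apply: emeasurable_funM => //; apply/measurable_EFinP.
- by move=> x _; rewrite lee_fin powR_ge0.
rewrite ge0_integralZl//; last by apply/measurable_EFinP.
apply: lte_add_pinfty.
  rewrite integral_cst//; apply: lte_mul_pinfty; rewrite ?lee_fin ?powR_ge0//.
  exact: lebesgue_rV_bounded.
apply: lte_mul_pinfty => //.
by have := Hn n0 (leqnn _) => /le_lt_trans; apply; exact: ltry.
Qed.

Definition couplingE (f g : 'rV[R]_N -> R) : \bar R :=
  (\int[Leb]_(x in Omega) (density x (f x) (g x))%:E)%E.

Lemma couplingE_ge0 f g : (0 <= couplingE f g)%E.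
Proof. by apply: integral_ge0 => x _; rewrite lee_fin density_ge0. Qed.

Lemma lty_integralD (f g : 'rV[R]_N -> R) :
  measurable_fun Omega (f : 'rV[R]_N -> measurableTypeR R) ->
  measurable_fun Omega (g : 'rV[R]_N -> measurableTypeR R) ->
  (forall x, 0 <= f x) -> (forall x, 0 <= g x) ->
  (\int[Leb]_(x in Omega) (f x)%:E < +oo)%E ->
  (\int[Leb]_(x in Omega) (g x)%:E < +oo)%E ->
  (\int[Leb]_(x in Omega) (f x + g x)%:E < +oo)%E.
Proof.
move=> mf mg f0 g0 fi gi.
under eq_integral do rewrite EFinD.
rewrite ge0_integralD//; try (by move=> x _; rewrite lee_fin);
  try exact/measurable_EFinP.
exact: lte_add_pinfty.
Qed.

Lemma measurable_quot_sqnorm u :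
  measurable_fun Omega (fun x => `|u x| ^+ 2 / sqnorm x : measurableTypeR R).
Proof.
apply: measurable_funM; last exact: measurable_sqnormV.
by apply: measurable_funX; exact: mD12n.
Qed.

(** The Hardy-Sobolev inequality, in qualitative form. *)
Lemma couplingE_fin u v :
  (couplingE (fun x => `|u x|%R) (fun x => `|v x|%R) < +oo)%E.
Proof.
pose W (w : D12_0 Omega) (x : 'rV[R]_N) := `|w x| ^+ 2 / sqnorm x + `|w x| `^ twostar N 0.
have mq (w : D12_0 Omega) : measurable_fun Omega
    (fun x => `|w x| `^ twostar N 0 : measurableTypeR R).
  by apply: measurable_powR_norm; exact: D12_measurable_fun.
have mW (w : D12_0 Omega) :
    measurable_fun Omega (W w : _ -> measurableTypeR R).
  by apply: measurable_funD; [exact: measurable_quot_sqnorm|exact: mq].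
have q0 (w : D12_0 Omega) x : 0 <= `|w x| ^+ 2 / sqnorm x.
  by rewrite divr_ge0 ?sqr_ge0 ?sqnorm_ge0.
have W0 (w : D12_0 Omega) x : 0 <= W w x by rewrite addr_ge0 ?powR_ge0.
have Wfin (w : D12_0 Omega) : (\int[Leb]_(x in Omega) (W w x)%:E < +oo)%E.
  apply: lty_integralD => //.
  - exact: measurable_quot_sqnorm.
  - under eq_integral do rewrite real_normK ?num_real//.
    apply: le_lt_trans (D12_hardy N3 oO w) _.
    by apply: lte_mul_pinfty => //; exact: dirichlet_fin.
  - exact: D12_Lcrit.
have K0 : 0 <= lambda + mu + p * kappa.
  rewrite !addr_ge0 ?(ltW l0) ?(ltW m0)// mulr_ge0 ?(ltW k0)//.
  by have := twostar_gt2; lra.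
apply: (@le_lt_trans _ _ (\int[Leb]_(x in Omega)
   ((lambda + mu + p * kappa)%:E * (W u x + W v x)%:E))%E).
  apply: ge0_le_integral => //.
  - by move=> x _; rewrite lee_fin density_ge0.
  - by apply/measurable_EFinP; apply: measurable_density; exact: mD12n.
  - apply: emeasurable_funM => //; apply/measurable_EFinP.
    exact: (measurable_funD (mW u) (mW v)).
  - by move=> x _; rewrite -EFinM lee_fin; exact: density_le.
rewrite ge0_integralZl//; last 2 first.
- by apply/measurable_EFinP; exact: (measurable_funD (mW u) (mW v)).
- by move=> x _; rewrite lee_fin addr_ge0.
by apply: lte_mul_pinfty => //; exact: lty_integralD.
Qed.

Lemma integral_gt0_nonzero u v (g : 'rV[R]_N -> R) :
  measurable_fun Omega (g : 'rV[R]_N -> measurableTypeR R) ->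
  (forall x, 0 <= g x) ->
  (forall x, x != 0 -> g x = 0 -> u x = 0 /\ v x = 0) ->
  nonzero_pair u v -> (0 < \int[Leb]_(x in Omega) (g x)%:E)%E.
Proof.
move=> mg g0 guv nz.
rewrite lt_neqAle integral_ge0 ?andbT; last by move=> x _; rewrite lee_fin.
apply/negP => /eqP g00; apply: nz.
have /(ae_eq_integral_abs Leb mO) [+ _] : measurable_fun Omega (EFin \o g).
  exact/measurable_EFinP.
have -> : (\int[Leb]_(x in Omega) `|(EFin \o g) x| = 0)%E.
  by rewrite [RHS]g00; apply: eq_integral => x _; rewrite /= ger0_norm.
move=> /(_ erefl) gae.
by split; apply: filterS2 gae (ae_neq0 N3) => x gx x0 Ox;
  have := gx Ox => -[] /(guv _ x0)[].
Qed.

Lemma weighted_powR_eq0 (x : 'rV[R]_N) (c a q : R) : x != 0 -> 0 < c ->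
  c * a `^ q / enorm x `^ s = 0 -> a = 0.
Proof.
move=> x0 c0 /eqP; rewrite mulf_eq0 invr_eq0 mulf_eq0 (gt_eqF c0)/=.
have rp : 0 < enorm x by rewrite sqrtr_gt0; exact: sqnorm_gt0.
by rewrite (gt_eqF (powR_gt0 _ rp)) orbF => /eqP /powR_eq0_eq0.
Qed.

Lemma density_eq0 x a b : x != 0 -> density x a b = 0 -> a = 0 /\ b = 0.
Proof.
move=> x0; have l0' := ltW l0; have m0' := ltW m0; have k0' := ltW k0.
have p0 : 0 <= p by apply: ltW; have := twostar_gt2; lra.
have r0 : 0 <= (enorm x `^ s)^-1 by rewrite invr_ge0 powR_ge0.
rewrite /density !mulrA.
set A := lambda * _ / _; set B := mu * _ / _; set C := _ * _ / _.
have A0 : 0 <= A.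
  by rewrite /A; apply: mulr_ge0 => //; apply: mulr_ge0; rewrite ?powR_ge0.
have B0 : 0 <= B.
  by rewrite /B; apply: mulr_ge0 => //; apply: mulr_ge0; rewrite ?powR_ge0.
have C0 : 0 <= C.
  rewrite /C; apply: mulr_ge0 => //; apply: mulr_ge0; rewrite ?powR_ge0//.
  by apply: mulr_ge0; rewrite ?powR_ge0//; apply: mulr_ge0.
move=> S0; split.
- by apply: (weighted_powR_eq0 x0 l0 (q := p)); rewrite -/A; lra.
- by apply: (weighted_powR_eq0 x0 m0 (q := p)); rewrite -/B; lra.
Qed.

Lemma gain_eq0 x a b : x != 0 -> gain x a b = 0 -> a = 0 /\ b = 0.
Proof.
move=> x0; rewrite /gain mulrDl.
have l0' := ltW l0; have m0' := ltW m0.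
have r0 : 0 <= (enorm x `^ s)^-1 by rewrite invr_ge0 powR_ge0.
set A := lambda * _ / _; set B := mu * _ / _.
have A0 : 0 <= A.
  by rewrite /A; apply: mulr_ge0 => //; apply: mulr_ge0; rewrite ?powR_ge0.
have B0 : 0 <= B.
  by rewrite /B; apply: mulr_ge0 => //; apply: mulr_ge0; rewrite ?powR_ge0.
move=> S0; split.
- by apply: (weighted_powR_eq0 x0 l0 (q := p - 1)); rewrite -/A; lra.
- by apply: (weighted_powR_eq0 x0 m0 (q := p - 1)); rewrite -/B; lra.
Qed.

Lemma norm_pair_eq0 (u v : 'rV[R]_N -> R) x :
  `|u x| = 0 /\ `|v x| = 0 -> u x = 0 /\ v x = 0.
Proof. by move=> [/normr0_eq0 -> /normr0_eq0 ->]. Qed.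

Lemma couplingE_gt0 u v : nonzero_pair u v ->
  (0 < couplingE (fun x => `|u x|%R) (fun x => `|v x|%R))%E.
Proof.
apply: integral_gt0_nonzero; first by apply: measurable_density; exact: mD12n.
  by move=> x; exact: density_ge0.
by move=> x x0 /(density_eq0 x0); exact: norm_pair_eq0.
Qed.

Lemma gain_gt0 u v : nonzero_pair u v ->
  (0 < \int[Leb]_(x in Omega) (gain x `|u x| `|v x|)%:E)%E.
Proof.
apply: integral_gt0_nonzero; first by apply: measurable_gain; exact: mD12n.
  by move=> x; exact: gain_ge0.
by move=> x x0 /(gain_eq0 x0); exact: norm_pair_eq0.
Qed.

Lemma couplingK u v :
  (coupling s lambda mu kappa alpha beta u v)%:E =
  couplingE (fun x => `|u x|%R) (fun x => `|v x|%R).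
Proof.
rewrite /coupling /Rintegral fineK// ge0_fin_numE; first exact: couplingE_fin.
exact: couplingE_ge0.
Qed.

Lemma energyE u v : (energy u v)%:E = (dirichlet u + dirichlet v)%E.
Proof.
have -> : (dirichlet u + dirichlet v = \int[Leb]_(x in Omega)
   (enorm (D12_grad u x) ^+ 2 + enorm (D12_grad v x) ^+ 2)%:E)%E.
  under [RHS]eq_integral do rewrite !enorm2 EFinD.
  have mg w :
      measurable_fun Omega (fun x => (sqnorm (@D12_grad _ _ Omega w x))%:E).
    by apply: measurable_sqnormE; exact: D12_measurable_grad.
  rewrite ge0_integralD//; by move=> x _; rewrite lee_fin sqnorm_ge0.
rewrite /energy /Rintegral fineK// ge0_fin_numE; last first.
  by apply: integral_ge0 => x _; rewrite lee_fin addr_ge0 ?sqr_ge0.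
under eq_integral do rewrite !enorm2.
have mg w : measurable_fun Omega
    (fun x => sqnorm (@D12_grad _ _ Omega w x) : measurableTypeR R).
  by apply: measurable_sqnorm; exact: D12_measurable_grad.
apply: lty_integralD => //.
- by move=> x; exact: sqnorm_ge0.
- by move=> x; exact: sqnorm_ge0.
- exact: dirichlet_fin.
- exact: dirichlet_fin.
Qed.

Lemma energy_ge0 u v : 0 <= energy u v.
Proof. by rewrite -lee_fin energyE adde_ge0// dirichlet_ge0. Qed.

(** By Hardy's inequality with a weight that vanishes nowhere. *)
Lemma dirichlet_eq0 u : dirichlet u = 0%E -> ae_zero Omega u.
Proof.
move=> d0; have := D12_hardy_reg N3 oO u (@ltr01 R); rewrite d0 mule0 => h.
pose g x := u x ^+ 2 * hweight 1 x.
have g0 x : 0 <= g x by rewrite mulr_ge0 ?sqr_ge0// ltW// hweight_gt0.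
have mg : measurable_fun Omega (EFin \o g).
  apply/measurable_EFinP; apply: measurable_funM.
    by apply: measurable_funX; exact: D12_measurable_fun.
  by apply: measurable_smooth; exact: smooth_hweight.
have := ae_eq_integral_abs Leb mO mg => -[+ _].
have -> : (\int[Leb]_(x in Omega) `|(EFin \o g) x| = 0)%E.
  apply/eqP; rewrite eq_le integral_ge0 ?andbT//; apply: le_trans h.
  by under eq_integral do rewrite /= ger0_norm//.
move=> /(_ erefl); apply: filterS => x gx Ox; have := gx Ox => -[] /eqP.
by rewrite mulf_eq0 sqrf_eq0 (gt_eqF (hweight_gt0 x ltr01)) orbF => /eqP.
Qed.

Lemma energy_gt0 u v : nonzero_pair u v -> 0 < energy u v.
Proof.
move=> nz; rewrite lt_neqAle energy_ge0 andbT; apply/eqP => e0; apply: nz.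
have : (dirichlet u + dirichlet v = 0)%E by rewrite -energyE -e0.
move=> /eqP; rewrite padde_eq0 ?dirichlet_ge0// => /andP[/eqP d1 /eqP d2].
by split; exact: dirichlet_eq0.
Qed.

(** The inequality that defines the infimum, without division. For a pair that
    vanishes almost everywhere the coupling, and so the left side, is 0. *)
Lemma S_inf_le u v :
  S_inf Omega s lambda mu kappa alpha beta *
    coupling s lambda mu kappa alpha beta u v `^ (2 / p) <= energy u v.
Proof.
set S := S_inf _ _ _ _ _ _ _; set C := coupling _ _ _ _ _ _ _ _.
have p2 := twostar_gt2.
have th0 : 2 / p != 0 by rewrite gt_eqF// divr_gt0//; lra.
have C0 : 0 <= C by rewrite -lee_fin couplingK couplingE_ge0.
have [->|Cn] := eqVneq C 0; first by rewrite powR0// mulr0 energy_ge0.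
have Cp : 0 < C by rewrite lt_neqAle eq_sym Cn.
rewrite -ler_pdivlMr ?powR_gt0//.
apply: inf_lbound.
  exists 0 => _ [u' [v' [_ ->]]].
  by rewrite /quotient divr_ge0 ?energy_ge0 ?powR_ge0.
exists u, v; split => // -[zu zv].
have : couplingE (fun x => `|u x|%R) (fun x => `|v x|%R) = 0%E.
  rewrite /couplingE (@ge0_ae_eq_integral _ _ _ Leb Omega _ (cst 0%E))//.
  - by rewrite integral0.
  - by apply/measurable_EFinP; apply: measurable_density; exact: mD12n.
  - by move=> x _; rewrite lee_fin density_ge0.
  - apply: filterS2 zu zv => x zu zv Ox /=; rewrite zu// zv// normr0 /density.
    have a0 : alpha != 0 by have := a1 => ?; rewrite gt_eqF//; lra.
    have pn : p != 0 by rewrite gt_eqF//; lra.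
    by rewrite (powR0 pn) (powR0 a0) !mul0r !mulr0 !addr0.
by rewrite -couplingK => -[]; apply/eqP.
Qed.

End density.

(** * Ingredients of the competitor *)

Section soft.
Context {R : realType}.

Definition soft (e y : R) : R := (e ^+ 2 + y * y) `^ (2^-1) - e.

Lemma soft_bounds (e y : R) : 0 < e ->
  [/\ 0 <= soft e y, soft e y <= `|y| & `|y| - e <= soft e y].
Proof.
move=> e0; rewrite /soft powR12_sqrt; last first.
  by rewrite addr_ge0// ?sqr_ge0// -expr2 sqr_ge0.
have n0 := normr_ge0 y.
have yy : y * y = `|y| ^+ 2 by rewrite real_normK// num_real.
have s1 : e <= Num.sqrt (e ^+ 2 + y * y).
  by rewrite -[leLHS]gtr0_norm// -sqrtr_sqr ler_wsqrtr// lerDl yy sqr_ge0.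
have s2 : `|y| <= Num.sqrt (e ^+ 2 + y * y).
  by rewrite -[leLHS]ger0_norm// -sqrtr_sqr ler_wsqrtr// yy lerDr sqr_ge0.
have s3 : Num.sqrt (e ^+ 2 + y * y) <= e + `|y|.
  rewrite -[leRHS]ger0_norm; last by rewrite addr_ge0// ltW.
  rewrite -sqrtr_sqr ler_wsqrtr// yy sqrrD.
  have : 0 <= e * `|y| by rewrite mulr_ge0// ltW.
  lra.
by split; lra.
Qed.

Lemma soft0 (e : R) : 0 < e -> soft e 0 = 0.
Proof. by move=> e0; have [] := soft_bounds 0 e0; rewrite normr0; lra. Qed.

Lemma cvg_soft (e y : nat -> R) (l : R) : (forall n, 0 < e n) ->
  e n @[n --> \oo] --> (0 : R) -> y n @[n --> \oo] --> l ->
  soft (e n) (y n) @[n --> \oo] --> `|l|.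
Proof.
move=> e0 ce cy; have cny : `|y n| @[n --> \oo] --> `|l| by exact: cvg_norm.
apply: (@squeeze_cvgr _ _ _ _ (fun n => `|y n| - e n) (fun n => `|y n|)) => //.
  by apply: nearW => n; have [_ -> ->] := soft_bounds (y n) (e0 n).
by rewrite -[X in _ --> X]subr0; exact: cvgB.
Qed.

Lemma smooth_soft N (e : R) (psi : 'rV[R]_N -> R) : 0 < e -> smooth psi ->
  smooth (fun x => soft e (psi x)).
Proof.
move=> e0 sp.
apply: (smoothD (f := fun x => (e ^+ 2 + psi x * psi x) `^ (2^-1))
                (g := cst (- e))); last exact: smooth_cst.
apply: smooth_powR; first exact: smoothD (smooth_cst _) (smoothM sp sp).
by move=> x; rewrite ltr_pwDl// ?exprn_gt0// -expr2 sqr_ge0.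
Qed.

(** The factor k is psi / sqrt(e^2 + psi^2): composing with soft does not
    increase the energy. *)
Lemma partial_soft N (e : R) (psi : 'rV[R]_N -> R) i x : 0 < e -> smooth psi ->
  exists k, k ^+ 2 <= 1 /\ partial i (fun x => soft e (psi x)) x = k * partial i psi x.
Proof.
move=> e0 sp; set X := e ^+ 2 + psi x * psi x.
have X0 : 0 < X by rewrite /X ltr_pwDl// ?exprn_gt0// -expr2 sqr_ge0.
have dpsi := is_derive_partial ((smooth_C1 sp).2 i x).
have d1 : is_derive x (delta_mx 0 i) (cst (e ^+ 2) + psi * psi)
    (0 + (psi x *: partial i psi x + psi x *: partial i psi x)).
  by apply: is_deriveD; exact: is_deriveM.
have d2 := is_derive_comp_line (@is_derive1_powR R 2^-1 X X0) d1.
have d3 := @is_deriveD _ _ _ _ (cst (- e)) _ _ _ _ d2 (is_derive_cst _ _ _).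
exists (psi x * X `^ (- 2^-1)); split.
  rewrite exprMn -[_ `^ _ ^+ 2]powR_mulrn ?powR_ge0// -powRrM mulNr mulVf//.
  rewrite powR_inv1 ?(ltW X0)//.
  by rewrite ler_pdivrMr// mul1r /X expr2 lerDr sqr_ge0.
rewrite (_ : (fun _ => _) =
  ((fun y : R => y `^ 2^-1) \o (cst (e ^+ 2) + psi * psi)) + cst (- e)) //.
rewrite (partial_is_derive d3) addr0 add0r /GRing.scale/=.
rewrite (_ : 2^-1 - 1 = - 2^-1 :> R); last by field.
by field.
Qed.

End soft.

Section real_contradiction.
Context {R : realType}.

(** Both exp z >= 1 + z and ln (1 / (1 + y)) <= 1 / (1 + y) - 1 are tangent
    line inequalities. *)
Lemma powR1D_ge (y th : R) : 0 <= y -> 0 <= th ->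
  1 + th * (y / (1 + y)) <= (1 + y) `^ th.
Proof.
move=> y0 th0; have y1 : 0 < 1 + y by rewrite ltr_wpDr.
rewrite /powR gt_eqF//.
apply: le_trans (expR_ge1Dx _); rewrite lerD2l ler_wpM2l//.
rewrite -[leRHS]opprK -lnV ?posrE// lerNr.
have h := @le_ln1Dx R ((1 + y)^-1 - 1).
rewrite [1 + (_ - 1)]addrC subrK in h; apply: le_trans (h _) _.
  by rewrite ltrBDr addNr invr_gt0.
by rewrite le_eqVlt; apply/orP; left; apply/eqP; field; rewrite gt_eqF.
Qed.

(** A first-order gain beats a second-order cost: by the tangent bound the left
    side of the hypothesis exceeds q C^th by a term A t / (1 + t k) with
    A, k > 0, which is larger than K t^2 for small t. *)
Lemma linear_gain_contradiction (q C m th K : R) :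
  0 < q -> 0 < C -> 0 < m -> 0 < th -> 0 <= K ->
  (forall t, 0 < t -> q * (C + t * m) `^ th <= q * C `^ th + t ^+ 2 * K) -> False.
Proof.
move=> q0 C0 m0 th0 K0 H.
pose k := m / C.
have kp : 0 < k by rewrite divr_gt0.
pose A := q * C `^ th * th * k.
have A0 : 0 < A by do 3 (apply: mulr_gt0 => //); exact: powR_gt0.
have key t : 0 < t -> A <= t * K * (1 + t * k).
  move=> t0; have tk : 0 < t * k by rewrite mulr_gt0.
  have := H t t0.
  rewrite (_ : C + t * m = C * (1 + t * k)); last first.
    by rewrite /k; field; rewrite gt_eqF.
  rewrite powRM ?(ltW C0)//; last by rewrite addr_ge0// ltW.
  have h := powR1D_ge (ltW tk) (ltW th0).
  have qC : 0 < q * C `^ th by rewrite mulr_gt0 ?powR_gt0.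
  move=> h2; have h1 := ler_wpM2l (ltW qC) h; rewrite mulrA in h2.
  have {h1 h2} := le_trans h1 h2.
  rewrite mulrDr mulr1 lerD2l.
  rewrite (_ : q * C `^ th * (th * (t * k / (1 + t * k))) =
    A * t / (1 + t * k)); last first.
    by rewrite /A !mulrA; congr (_ / _); ring.
  rewrite ler_pdivrMr; last by rewrite ltr_wpDl// ltW.
  by rewrite (_ : t ^+ 2 * K * _ = t * K * (1 + t * k) * t) ?ler_pM2r//; ring.
pose D := K * (1 + k) + 1.
have D0 : 0 < D by rewrite ltr_wpDl// mulr_ge0// addr_ge0// ltW.
pose t := Num.min 1 (A / (2 * D)).
have t0 : 0 < t by rewrite lt_min ltr01/= divr_gt0// mulr_gt0.
have t1 : t <= 1 by rewrite ge_min lexx.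
have t2 : t <= A / (2 * D) by rewrite ge_min lexx orbT.
have := key t t0; apply/negP; rewrite -ltNge.
apply: (@le_lt_trans _ _ (t * D)).
  rewrite -mulrA ler_pM2l// /D; apply: (@le_trans _ _ (K * (1 + k))); last by rewrite lerDl.
  by rewrite ler_wpM2l// lerD2l ler_piMl// ltW.
apply: (@le_lt_trans _ _ (A / (2 * D) * D)); first by rewrite ler_pM2r.
rewrite invfM mulrA divfK ?gt_eqF//.
lra.
Qed.

End real_contradiction.

Section cutoff.
Context {R : realType} {N : nat} (Omega : set 'rV[R]_N).
Hypotheses (oO : open Omega) (bO : bounded_set Omega) (O0 : Omega 0).

Lemma norm_le_sqnorm (x : 'rV[R]_N) (r : R) : 0 <= r -> sqnorm x <= r ^+ 2 -> `|x| <= r.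
Proof.
move=> r0 xr; apply: ler_norm_coord => // i.
rewrite -(ler_pXn2r (ltn0Sn 1)) ?nnegrE// real_normK ?num_real//.
apply: le_trans xr; rewrite /sqnorm (bigD1 i)//= lerDl.
by apply: sumr_ge0 => j _; exact: sqr_ge0.
Qed.

Lemma sqnorm_le_norm (x : 'rV[R]_N) (M : R) : `|x| <= M -> sqnorm x <= N%:R * M ^+ 2.
Proof.
move=> xM; rewrite -[N in N%:R]card_ord -sum1_card natr_sum mulr_suml.
apply: ler_sum => i _; rewrite mul1r -real_normK ?num_real//.
rewrite ler_pXn2r// ?nnegrE//; first exact: le_trans (ler_coord_norm _ _) xM.
by apply: le_trans xM.
Qed.

Lemma sqnormZ (c : R) (x : 'rV[R]_N) : sqnorm (c *: x) = c ^+ 2 * sqnorm x.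
Proof. by rewrite /sqnorm mulr_sumr; apply: eq_bigr => i _; rewrite mxE exprMn. Qed.

(** With rho such that the ball of radius rho lies in Omega, c = rho^2 / 4 and
    f = flat 0, the cutoff is f(a - f(|x|^2 - c)) where a = f(rho^2 - c): the
    inner f vanishes on the ball of radius rho / 2, where the cutoff is
    therefore constant, and is at least a outside the ball of radius rho, where
    the cutoff vanishes. The dilation factor tau brings Omega into the smaller
    ball. *)
Lemma cutoff_exists :
  exists (tau k : R) (eta : 'rV[R]_N -> R) (V : set 'rV[R]_N),
  [/\ 0 < tau, 0 < k, Cc_smooth Omega eta, (forall x, 0 <= eta x) &
   [/\ open V, (forall x, V x -> eta x = k) &
       (forall x, Omega (tau^-1 *: x) -> V x)]].
Proof.
have /nbhs_ballP[r /= r0 rO] := open_nbhs_nbhs (conj oO O0).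
pose rho := r / 2.
have rho0 : 0 < rho by rewrite divr_gt0.
have in_Omega x : `|x| <= rho -> Omega x.
  move=> xr; apply: rO; rewrite -ball_normE /= sub0r normrN.
  by apply: le_lt_trans xr _; rewrite /rho; lra.
pose c := rho ^+ 2 / 4.
have c0 : 0 < c by rewrite divr_gt0// exprn_gt0.
pose a := flat 0 (rho ^+ 2 - c).
have flat_gt0 y : 0 < y -> 0 < flat 0 y.
  by move=> y0; rewrite /flat y0 mul1r expR_gt0.
have flat0 y : y <= 0 -> flat 0 y = 0 by move=> y0; rewrite /flat ltNge y0.
have a0 : 0 < a.
  by apply: flat_gt0; rewrite /c; have := exprn_gt0 2 rho0; lra.
pose eta (x : 'rV[R]_N) := flat 0 (a - flat 0 (sqnorm x - c)).
have etaN x : eta x != 0 -> `|x| <= rho.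
  move=> ex; apply: norm_le_sqnorm; first exact: ltW.
  rewrite leNgt; apply: contraNN ex => xr; apply/eqP; apply: flat0.
  by rewrite subr_le0; apply: flat_mono; rewrite lerD2r ltW.
have supp_eta :
    closure [set x | eta x != 0] `<=` [set x : 'rV[R]_N | `|x| <= rho].
  have /closure_id -> : closed [set x : 'rV[R]_N | `|x| <= rho].
    by apply: compact_closed; [exact: norm_hausdorff|exact: compact_norm_le].
  exact: closure_subset.
have [M0 [_ HM0]] := bO.
pose M := M0 + 1.
have HM x : Omega x -> `|x| <= M by apply: HM0; rewrite ltrDl.
pose K := N%:R * M ^+ 2.
have K0 : 0 <= K by rewrite mulr_ge0// sqr_ge0.
pose tau := rho / (2 * (K + 1)).
have tau0 : 0 < tau by rewrite divr_gt0// mulr_gt0// ltr_wpDl.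
exists tau, (flat 0 a), eta, [set x | sqnorm x < c]; split => //.
- exact: flat_gt0.
- split.
  + apply: (smooth_flat (f := fun x => a - flat 0 (sqnorm x - c))).
    apply: (smoothD (f := cst a) (g := fun x => - flat 0 (sqnorm x - c)));
      first exact: smooth_cst.
    rewrite (_ : (fun _ => _) =
      cst (-1) * (flat 0 \o (fun x => sqnorm x - c))); last first.
      by apply/funext => x; rewrite fctE mulN1r.
    apply: smoothM; first exact: smooth_cst.
    apply: smooth_flat; apply: (smoothD (f := @sqnorm R N) (g := cst (- c))).
      exact: smooth_sqnorm.
    exact: smooth_cst.
  + apply: (subclosed_compact _ (@compact_norm_le R N rho)) => //.
    exact: closed_closure.
  + by move=> x /supp_eta /in_Omega.
- by move=> x; exact: flat_ge0.
- split.
  + apply: (@open_comp _ _ (@sqnorm R N) [set y | y < c]); last exact: open_lt.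
    by move=> x _; exact: smooth_continuous (@smooth_sqnorm R N) x.
  + move=> x /= xc; rewrite /eta [flat 0 (sqnorm x - c)]flat0 ?subr0//.
    by rewrite subr_le0 ltW.
  + move=> x /HM /sqnorm_le_norm; rewrite -/K sqnormZ => h /=.
    have t2 : 0 < tau ^+ 2 by rewrite exprn_gt0.
    have : sqnorm x <= tau ^+ 2 * K.
      by rewrite -ler_pdivrMl// -exprVn.
    move=> /le_lt_trans; apply.
    rewrite /tau /c expr_div_n [X in _ / X * _]exprMn -mulrA ltr_pM2l ?exprn_gt0//.
    rewrite invfM (_ : 2 ^+ 2 = 4); last by ring.
    rewrite -mulrA gtr_pMr ?invr_gt0// mulrC ltr_pdivrMr ?exprn_gt0 ?ltr_wpDl//.
    rewrite mul1r; nra.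
Qed.

End cutoff.

(** * The competitor *)

Section competitor.
Context {R : realType} {N : nat}.
Variables (s lambda mu kappa alpha beta : R) (Omega : set 'rV[R]_N).
Hypotheses (N3 : (3 <= N)%N) (s0 : 0 < s) (s2 : s < 2) (l0 : 0 < lambda)
  (m0 : 0 < mu) (k0 : 0 < kappa) (a1 : 1 < alpha) (b1 : 1 < beta)
  (ab : alpha + beta = twostar N s) (oO : open Omega).
Local Notation p := (twostar N s).
Local Notation Leb := (@lebesgue_rV R N).
Local Notation density := (density s lambda mu kappa alpha beta).

Let mO : measurable Omega := open_measurable_rV oO.

Variables (tau k : R) (eta : 'rV[R]_N -> R) (V : set 'rV[R]_N).
Hypotheses (tau0 : 0 < tau) (kp : 0 < k) (ceta : Cc_smooth Omega eta)
  (eta0 : forall x, 0 <= eta x) (oV : open V) (etaV : forall x, V x -> eta x = k)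
  (OV : forall x, Omega (tau^-1 *: x) -> V x).

Lemma V_sub : V `<=` Omega.
Proof.
move=> x Vx; apply: contrapT => /(Cc_out0 ceta) e0.
by move: kp; rewrite -(etaV Vx) e0 ltxx.
Qed.

(** The pair is shrunk to the set where tau^-1 x lies in Omega; the factor
    tau^(-(N-2)/2) of the usual dilation is omitted, as the quotient is
    homogeneous of degree 0. *)
Definition competitor (e t : R) (phi : 'rV[R]_N -> R) (x : 'rV[R]_N) : R :=
  soft e (phi (tau^-1 *: x)) + t * eta x.

Variables (e t : R).
Hypotheses (e0 : 0 < e) (t0 : 0 < t).

Lemma competitor_ge0 phi x : 0 <= competitor e t phi x.
Proof.
have [h _ _] := soft_bounds (phi (tau^-1 *: x)) e0.
by rewrite addr_ge0// mulr_ge0// ltW.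
Qed.

Lemma competitor_inner phi x : Omega x ->
  competitor e t phi (tau *: x) = soft e (phi x) + t * k.
Proof.
move=> Ox; rewrite /competitor scalerA mulVf ?gt_eqF// scale1r etaV//.
by apply: OV; rewrite scalerA mulVf ?gt_eqF// scale1r.
Qed.

Lemma competitor_smooth phi : smooth phi -> smooth (competitor e t phi).
Proof.
move=> sp; apply: (smoothD (f := fun x => soft e (phi (tau^-1 *: x)))
                           (g := cst t * eta)).
  exact: (smooth_soft e0 (smooth_scale tau^-1 sp)).
by apply: smoothM; [exact: smooth_cst|exact: Cc_smooth_smooth ceta].
Qed.

(** The support is that of eta, which is positive wherever the shrunk function
    does not vanish. *)
Lemma competitor_Cc phi : Cc_smooth Omega phi -> Cc_smooth Omega (competitor e t phi).
Proof.
move=> cphi; have [_ ce eO] := ceta.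
have sub : [set x | competitor e t phi x != 0] `<=` [set x | eta x != 0].
  move=> x; apply: contra_neq => ex; rewrite /competitor ex mulr0 addr0.
  rewrite (Cc_out0 cphi) ?soft0// => /OV /etaV.
  by rewrite ex => k00; move: kp; rewrite -k00 ltxx.
have csub := closure_subset sub.
split.
- exact: competitor_smooth (Cc_smooth_smooth cphi).
- by apply: (subclosed_compact _ ce) => //; exact: closed_closure.
- exact: subset_trans csub eO.
Qed.

(** There is no cross term: eta is constant near every point of V, and phi
    vanishes near tau^-1 x when x is outside V. *)
Lemma partial_competitor phi i x : Cc_smooth Omega phi ->
  partial i (competitor e t phi) x ^+ 2 <=
  tau^-1 ^+ 2 * partial i phi (tau^-1 *: x) ^+ 2 +
  t ^+ 2 * partial i eta x ^+ 2.
Proof.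
move=> cphi; have sp := Cc_smooth_smooth cphi; have se := Cc_smooth_smooth ceta.
pose psi x := phi (tau^-1 *: x).
have spsi : smooth psi by exact: smooth_scale.
have psiE : partial i psi x = tau^-1 * partial i phi (tau^-1 *: x).
  apply: partial_is_derive; apply: is_derive_scale.
  by apply: is_derive_partial; exact: (smooth_C1 sp).2.
have [c [c1 cE]] := partial_soft i x e0 spsi.
have wE : partial i (competitor e t phi) x =
    c * partial i psi x + t * partial i eta x.
  rewrite -cE; apply: partial_is_derive.
  apply: (@is_deriveD _ _ _ (fun x => soft e (psi x)) (fun x => t * eta x)).
    apply: is_derive_partial.
    exact: (smooth_C1 (smooth_soft e0 spsi)).2.
  apply: (@is_deriveZ _ _ _ eta).
  by apply: is_derive_partial; exact: (smooth_C1 se).2.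
have cross : partial i psi x * partial i eta x = 0.
  have [Vx|nVx] := pselect (V x).
    rewrite [partial i eta x](_ : _ = 0) ?mulr0//.
    rewrite /partial (@near_eq_derive _ _ _ eta (cst k)) ?derive_cst//.
    by near=> y; apply: etaV; near: y; exact: open_nbhs_nbhs.
  by rewrite psiE (Cc_out_partial _ cphi) ?mulr0 ?mul0r// => /OV.
rewrite wE -exprMn -psiE sqrrD exprMn exprMn.
rewrite (_ : c * partial i psi x * (t * partial i eta x) =
  c * t * (partial i psi x * partial i eta x)); last by ring.
rewrite cross mulr0 mul0rn addr0 lerD2r.
by rewrite ler_piMl// sqr_ge0.
Unshelve. all: by end_near. Qed.

Lemma dirichlet_competitor phi : Cc_smooth Omega phi ->
  (\int[Leb]_(x in Omega) (sqnorm (grad (competitor e t phi) x))%:E <=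
   (tau ^+ N / tau ^+ 2)%:E * \int[Leb]_(x in Omega) (sqnorm (grad phi x))%:E +
   (t ^+ 2)%:E * \int[Leb]_(x in Omega) (sqnorm (grad eta x))%:E)%E.
Proof.
move=> cphi; have sp := Cc_smooth_smooth cphi; have se := Cc_smooth_smooth ceta.
have sw := competitor_smooth sp; have cw := competitor_Cc cphi.
have mphi : measurable_fun setT (fun x => (sqnorm (grad phi x))%:E).
  by apply/measurable_EFinP; apply: measurable_sqnorm; exact: measurable_grad.
have mphit : measurable_fun setT
    (fun x : 'rV[R]_N => (sqnorm (grad phi (tau^-1 *: x)))%:E).
  by apply: (measurableT_comp mphi); exact: measurable_rV_scale.
have meta : measurable_fun setT (fun x => (sqnorm (grad eta x))%:E).
  by apply/measurable_EFinP; apply: measurable_sqnorm; exact: measurable_grad.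
have mw : measurable_fun setT
    (fun x => (sqnorm (grad (competitor e t phi) x))%:E).
  by apply/measurable_EFinP; apply: measurable_sqnorm; exact: measurable_grad.
have n0 (f : 'rV[R]_N -> 'rV[R]_N) x : (0 <= (sqnorm (f x))%:E)%E.
  by rewrite lee_fin sqnorm_ge0.
rewrite -!integral_grad_setT//.
apply: (@le_trans _ _ (\int[Leb]_x
    ((tau^-1 ^+ 2)%:E * (sqnorm (grad phi (tau^-1 *: (x : 'rV[R]_N))%R))%:E
     + (t ^+ 2)%:E * (sqnorm (grad eta x))%:E))%E).
  apply: ge0_le_integral => //.
  - exact: (emeasurable_lincomb _ _ mphit meta).
  - move=> x _; rewrite -!EFinM -EFinD lee_fin /sqnorm !mulr_sumr -big_split/=.
    apply: ler_sum => i _; rewrite !mxE; exact: partial_competitor.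
rewrite (ge0_integral_lincomb Leb measurableT (sqr_ge0 _) (sqr_ge0 _) mphit meta
  (fun x _ => n0 (fun y => grad phi (tau^-1 *: y)) x)
  (fun x _ => n0 (grad eta) x)).
have -> : (\int[Leb]_x (sqnorm (grad phi (tau^-1 *: (x : 'rV[R]_N))%R))%:E =
    (tau ^+ N)%:E * \int[Leb]_x (sqnorm (grad phi x))%:E)%E.
  rewrite (ge0_integral_scale tau0 mphit) => [|x]; last first.
    by rewrite lee_fin sqnorm_ge0.
  by under eq_integral do rewrite scalerA mulVf ?gt_eqF// scale1r.
by rewrite muleA -EFinM exprVn mulrC.
Qed.

(** Keep only the part of Omega where tau^-1 x lies in Omega; there eta = k, and
    the change of variables x = tau y produces tau^N / tau^s. *)
Lemma coupling_competitor phi chi : Cc_smooth Omega phi -> Cc_smooth Omega chi ->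
  ((tau ^+ N / tau `^ s)%:E * \int[Leb]_(x in Omega)
     (density x (soft e (phi x) + t * k)%R (soft e (chi x) + t * k)%R)%:E <=
   couplingE s lambda mu kappa alpha beta Omega
     (fun x => `|competitor e t phi x|%R) (fun x => `|competitor e t chi x|%R))%E.
Proof.
move=> cphi cchi.
pose w := competitor e t phi; pose z := competitor e t chi.
have mw : measurable_fun setT (w : _ -> measurableTypeR R).
  apply: measurable_smooth; apply: competitor_smooth.
  exact: Cc_smooth_smooth cphi.
have mz : measurable_fun setT (z : _ -> measurableTypeR R).
  apply: measurable_smooth; apply: competitor_smooth.
  exact: Cc_smooth_smooth cchi.
have mwz : measurable_fun setT (fun x => (density x (w x) (z x))%:E).
  by apply/measurable_EFinP; exact: measurable_density.
have d0 (x : 'rV[R]_N) (a b : R) : (0 <= (density x a b)%:E)%E.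
  by rewrite lee_fin; exact: (density_ge0 alpha beta N3 s2 l0 m0 k0).
rewrite /couplingE [leRHS](eq_integral
  (fun x => (density x (w x) (z x))%:E)); last first.
  by move=> x _; rewrite !ger0_norm//; exact: competitor_ge0.
pose B := (fun x : 'rV[R]_N => tau^-1 *: x) @^-1` Omega.
have mB : measurable B.
  by rewrite -[X in measurable X]setTI; exact: measurable_rV_scale.
have BO : B `<=` Omega by move=> x /OV /V_sub.
apply: (@le_trans _ _ (\int[Leb]_(x in B) (density x (w x) (z x))%:E)%E); last first.
  by apply: ge0_subset_integral => //; exact: measurable_funTS.
rewrite [leRHS]integral_mkcond (ge0_integral_scale tau0); last 2 first.
- by apply/(measurable_restrictT _ mB); exact: measurable_funTS.
- by move=> x; rewrite patchE; case: ifP.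
have -> : (\int[Leb]_x ((fun x => (density x (w x) (z x))%:E) \_ B)
     (tau *: (x : 'rV[R]_N))%R =
   \int[Leb]_(x in Omega) ((tau `^ s)^-1%:E *
     (density x (soft e (phi x) + t * k)%R (soft e (chi x) + t * k)%R)%:E))%E.
  rewrite [RHS]integral_mkcond; apply: eq_integral => x _; rewrite !patchE.
  have -> : (tau *: x \in B) = (x \in Omega).
    by apply/idP/idP; rewrite !inE /B /= scalerA mulVf ?gt_eqF// scale1r.
  case: ifPn => // /[!inE] Ox.
  by rewrite /w /z !competitor_inner// density_scale.
have msoft f : Cc_smooth Omega f ->
    measurable_fun Omega (fun x => soft e (f x) + t * k : measurableTypeR R).
  move=> cf; apply: measurable_funD => //; apply: measurable_smooth.
  by apply: smooth_soft => //; exact: Cc_smooth_smooth cf.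
rewrite ge0_integralZl//; last 2 first.
- by apply/measurable_EFinP; apply: measurable_density; exact: msoft.
- by rewrite lee_fin invr_ge0 powR_ge0.
by rewrite muleA -EFinM.
Qed.

End competitor.

(** * Minimizers do not exist *)

Section minimizer.
Context {R : realType} {N : nat}.
Variables (s lambda mu kappa alpha beta : R) (Omega : set 'rV[R]_N).
Hypotheses (N3 : (3 <= N)%N) (s0 : 0 < s) (s2 : s < 2) (l0 : 0 < lambda)
  (m0 : 0 < mu) (k0 : 0 < kappa) (a1 : 1 < alpha) (b1 : 1 < beta)
  (ab : alpha + beta = twostar N s)
  (oO : open Omega) (bO : bounded_set Omega) (O0 : Omega 0).
Local Notation p := (twostar N s).
Local Notation Leb := (@lebesgue_rV R N).
Local Notation density := (density s lambda mu kappa alpha beta).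
Local Notation coupling := (@coupling R N Omega s lambda mu kappa alpha beta).
Local Notation couplingE := (couplingE s lambda mu kappa alpha beta Omega).
Local Notation Sinf := (S_inf Omega s lambda mu kappa alpha beta).

Let mO : measurable Omega := open_measurable_rV oO.

(** Energy and coupling^(2/p) scale by the same factor under dilations; this is
    the criticality of the exponent p. *)
Lemma twostar_scale (tau : R) : 0 < tau ->
  (tau ^+ N / tau `^ s) `^ (2 / p) = tau ^+ N / tau ^+ 2.
Proof.
move=> t0; have N3r : 3 <= N%:R :> R by rewrite ler_nat.
rewrite -!powR_mulrn ?(ltW t0)// -!powRN -!powRD ?(gt_eqF t0) ?implybT// -powRrM.
congr (_ `^ _); rewrite /twostar; field.
have s2' := s2.
by apply/andP; split; rewrite gt_eqF//; lra.
Qed.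

(** The inequality S_inf_le for the competitors built from approximations of u
    and v, in the limit. The accuracy t^2 is imposed on the energies of the
    approximations so that their error is absorbed in the O(t^2) term. *)
Lemma test_inequality (u v : D12_0 Omega) (t : R) (tau k : R)
    (eta : 'rV[R]_N -> R) (V : set 'rV[R]_N) :
  0 < tau -> 0 < k -> Cc_smooth Omega eta -> (forall x, 0 <= eta x) ->
  open V -> (forall x, V x -> eta x = k) ->
  (forall x, Omega (tau^-1 *: x) -> V x) -> 0 < t -> 0 < Sinf ->
  (couplingE (fun x => `|u x| + t * k)%R (fun x => `|v x| + t * k)%R <=
   (((energy u v + t ^+ 2 * (2 + 2 *
     fine (\int[Leb]_(x in Omega) (sqnorm (grad eta x))%:E)%E / (tau ^+ N / tau ^+ 2))) / Sinf)
       `^ (p / 2))%:E)%E.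
Proof.
have regroup (a b c d : R) : c != 0 ->
    c * (a + b * (2 + 2 * d / c)) = c * (a + 2 * b) + 2 * b * d.
  by move=> c0; field.
have p2 := twostar_gt2 N3 s2.
have p0 : p != 0 by rewrite gt_eqF//; lra.
have th0 : 0 <= 2 / p by rewrite divr_ge0//; lra.
have th0' : 0 <= p / 2 by rewrite divr_ge0//; lra.
have th1 : 2 / p * (p / 2) = 1 by field.
move=> tau0 kp ceta eta0 oV etaV OV t0 S0.
set Keta := fine _; set T := tau ^+ N / tau ^+ 2.
have T0 : 0 < T by rewrite divr_gt0// exprn_gt0.
have KetaE : (\int[Leb]_(x in Omega) (sqnorm (grad eta x))%:E = Keta%:E)%E.
  rewrite fineK// ge0_fin_numE ?integral_grad_fin//.
  by apply: integral_ge0 => x _; rewrite lee_fin sqnorm_ge0.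
have tt0 : 0 < t ^+ 2 by rewrite exprn_gt0.
have [phi [chi [cphi cchi phiE chiE ae]]] := D12_approx_ae N3 oO u v tt0.
pose e n : R := n.+1%:R^-1.
have e0 n : 0 < e n by rewrite invr_gt0.
have msoft f n : Cc_smooth Omega f -> measurable_fun Omega
    (fun x => soft (e n) (f x) + t * k : measurableTypeR R).
  move=> cf; apply: measurable_funD => //; apply: measurable_smooth.
  by apply: smooth_soft => //; exact: Cc_smooth_smooth cf.
have mnorm (w : D12_0 Omega) :
    measurable_fun Omega (fun x => `|w x| + t * k : measurableTypeR R).
  apply: measurable_funD => //; apply: measurableT_comp => //.
  exact: D12_measurable_fun.
have d0 (x : 'rV[R]_N) (a b : R) : (0 <= (density x a b)%:E)%E.
  by rewrite lee_fin; exact: (density_ge0 alpha beta N3 s2 l0 m0 k0).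
have tk0 : 0 < t * k by rewrite mulr_gt0.
apply: (@fatou_ae_le _ _ _ Leb Omega mO
   (fun n x => (density x (soft (e n) (phi n x) + t * k)
                         (soft (e n) (chi n x) + t * k))%:E)).
- by move=> n; apply/measurable_EFinP; apply: measurable_density; exact: msoft.
- by apply/measurable_EFinP; apply: measurable_density; exact: mnorm.
- by [].
- by [].
- apply: filterS ae => x Hx Ox; have [Hu Hv] := Hx Ox.
  have cu : soft (e n) (phi n x) + t * k @[n --> \oo] --> `|u x| + t * k.
    by apply: cvgD; [apply: cvg_soft => //; exact: cvg_harmonic|exact: cvg_cst].
  have cv : soft (e n) (chi n x) + t * k @[n --> \oo] --> `|v x| + t * k.
    by apply: cvgD; [apply: cvg_soft => //; exact: cvg_harmonic|exact: cvg_cst].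
  apply: cvg_EFin; first by apply: nearW.
  have cpow (y : nat -> R) (l q : R) : y n @[n --> \oo] --> l -> 0 < l ->
      y n `^ q @[n --> \oo] --> l `^ q.
    move=> cy lp; have cl : {for l, continuous (fun z : R => z `^ q)}; last first.
      exact: cvg_comp cy cl.
    apply: differentiable_continuous; apply/derivable1_diffP.
    by apply: derivable_powR; rewrite in_itv/= andbT.
  have up : 0 < `|u x| + t * k by rewrite ltr_wpDl.
  have vp : 0 < `|v x| + t * k by rewrite ltr_wpDl.
  rewrite /density; apply: cvgD; first apply: cvgD.
  + by apply: cvgMr; apply: cvgMl; exact: cpow.
  + by apply: cvgMr; apply: cvgMl; exact: cpow.
  + by apply: cvgMr; apply: cvgMl; apply: cvgM; exact: cpow.
move=> n.
have [W [WE WG]] := test_D12 N3 oO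
  (competitor_Cc kp ceta etaV OV t (e0 n) (cphi n)).
have [Z [ZE ZG]] := test_D12 N3 oO
  (competitor_Cc kp ceta etaV OV t (e0 n) (cchi n)).
set I := (\int[Leb]_(x in Omega) _)%E.
have hC : ((tau ^+ N / tau `^ s)%:E * I <= (coupling W Z)%:E)%E.
  rewrite (couplingK N3 s0 s2 l0 m0 k0 a1 b1 ab oO bO) WE ZE.
  exact: (coupling_competitor alpha beta N3 s2 l0 m0 k0 oO tau0 kp ceta eta0
    etaV OV (e0 n) t0 (cphi n) (cchi n)).
pose c := tau ^+ N / tau `^ s.
have c0 : 0 < c by rewrite divr_gt0 ?exprn_gt0 ?powR_gt0.
have I0 : (0 <= I)%E by apply: integral_ge0.
have Ifin : I \is a fin_num.
  rewrite ge0_fin_numE//; rewrite ltNge; apply/negP; rewrite leye_eq => /eqP Iy.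
  by move: hC; rewrite Iy gt0_muley ?lte_fin// leye_eq.
move: hC I0; rewrite -(fineK Ifin) -EFinM !lee_fin; set i := fine I => hC i0.
have hE : energy W Z <= T * (energy u v + 2 * t ^+ 2) + 2 * t ^+ 2 * Keta.
  rewrite -lee_fin (energyE oO) /dirichlet WG ZG.
  have hD := dirichlet_competitor oO tau0 kp ceta oV etaV OV t (e0 n).
  apply: (@le_trans _ _
    ((T%:E * (dirichlet u + (t ^+ 2)%:E) + (t ^+ 2)%:E * Keta%:E) +
     (T%:E * (dirichlet v + (t ^+ 2)%:E) + (t ^+ 2)%:E * Keta%:E))%E).
    apply: leeD.
      apply: le_trans (hD _ (cphi n)) _; rewrite KetaE leeD2r//.
      by apply: lee_wpmul2l => //; rewrite lee_fin ltW.
    apply: le_trans (hD _ (cchi n)) _; rewrite KetaE leeD2r//.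
    by apply: lee_wpmul2l => //; rewrite lee_fin ltW.
  have [Du uE] : exists Du, dirichlet u = Du%:E.
    exists (fine (dirichlet u)).
    by rewrite fineK// ge0_fin_numE ?dirichlet_ge0 ?dirichlet_fin.
  have [Dv vE] : exists Dv, dirichlet v = Dv%:E.
    exists (fine (dirichlet v)).
    by rewrite fineK// ge0_fin_numE ?dirichlet_ge0 ?dirichlet_fin.
  have := energyE oO u v; rewrite uE vE -EFinD => -[->].
  rewrite -!(EFinD, EFinM) lee_fin le_eqVlt.
  by apply/orP; left; apply/eqP; ring.
have hS := S_inf_le N3 s0 s2 l0 m0 k0 a1 b1 ab oO bO W Z.
have ip : Sinf * i `^ (2 / p) <= energy u v + t ^+ 2 * (2 + 2 * Keta / T).
  rewrite -(ler_pM2l T0); apply: le_trans (_ : _ <= Sinf * coupling W Z `^ (2 / p)) _.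
    rewrite mulrCA ler_pM2l// /T -(twostar_scale tau0) -powRM ?(ltW c0)//.
    have ci0 : 0 <= tau ^+ N / tau `^ s * i by rewrite mulr_ge0// ltW.
    have WZ0 : 0 <= coupling W Z := le_trans ci0 hC.
    by apply: (ge0_ler_powR th0) hC; rewrite nnegrE.
  apply: (le_trans hS); apply: (le_trans hE).
  by rewrite regroup// gt_eqF.
rewrite (_ : i = (i `^ (2 / p)) `^ (p / 2)); last first.
  by rewrite -powRrM th1 powRr1.
rewrite ge0_ler_powR ?nnegrE ?powR_ge0//.
- by rewrite divr_ge0 ?(ltW S0)//; apply: le_trans ip; rewrite mulr_ge0 ?powR_ge0 ?ltW.
- by rewrite ler_pdivlMr// mulrC.
Qed.

Lemma not_attained : ~ S_attained Omega s lambda mu kappa alpha beta.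
Proof.
move=> [u [v [nz quv]]].
have p2 := twostar_gt2 N3 s2.
have th0 : 0 <= 2 / p by rewrite divr_ge0//; lra.
have th1 : p / 2 * (2 / p) = 1 by field; rewrite gt_eqF//; lra.
have [tau [k [eta [V [tau0 kp ceta eta0 [oV etaV OV]]]]]] := cutoff_exists oO bO O0.
have E0 : 0 < energy u v by exact: energy_gt0.
have C0 : 0 < coupling u v.
  rewrite -lte_fin (couplingK N3 s0 s2 l0 m0 k0 a1 b1 ab oO bO).
  exact: couplingE_gt0.
have Cth : 0 < coupling u v `^ (2 / p) by exact: powR_gt0.
have S0 : 0 < Sinf by rewrite -quv divr_gt0.
have SE : energy u v = Sinf * coupling u v `^ (2 / p).
  by rewrite -quv /quotient divfK// gt_eqF.
set Keta := fine (\int[Leb]_(x in Omega) (sqnorm (grad eta x))%:E)%E.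
have Keta0 : 0 <= Keta.
  rewrite /Keta fine_ge0//; apply: integral_ge0 => x _.
  by rewrite lee_fin sqnorm_ge0.
pose T := tau ^+ N / tau ^+ 2.
have T0 : 0 < T by rewrite divr_gt0// exprn_gt0.
have g0 := gain_gt0 s N3 l0 m0 oO nz.
set G := (\int[_]_(x in _) _)%E in g0.
have [c [c0 cG]] : exists c : R, 0 < c /\ (c%:E <= G)%E.
  case: G g0 => [g|_|//]; first by rewrite lte_fin => g0; exists g.
  by exists 1; rewrite ltr01 leey.
apply: (@linear_gain_contradiction R Sinf (coupling u v) (k * c) (2 / p)
  (2 + 2 * Keta / T)) => //.
- exact: mulr_gt0.
- by rewrite divr_gt0//; lra.
- by rewrite addr_ge0// mulr_ge0 ?invr_ge0 ?(ltW T0)// mulr_ge0.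
move=> t t0; have tk0 : 0 < t * k by rewrite mulr_gt0.
have := test_inequality u v tau0 kp ceta eta0 oV etaV OV t0 S0.
rewrite -/Keta -/T; set B := energy u v + _ => hB.
have B0 : 0 <= B / Sinf.
  rewrite divr_ge0 ?(ltW S0)// addr_ge0 ?(ltW E0)//.
  by rewrite mulr_ge0 ?sqr_ge0// addr_ge0// mulr_ge0 ?invr_ge0 ?(ltW T0)// mulr_ge0.
have hC : (coupling u v + t * (k * c) <= (B / Sinf) `^ (p / 2)).
  rewrite -lee_fin; apply: le_trans hB.
  rewrite EFinD (couplingK N3 s0 s2 l0 m0 k0 a1 b1 ab oO bO) mulrA.
  apply: (@le_trans _ _ (couplingE (fun x => `|u x|%R) (fun x => `|v x|%R) +
    (t * k)%:E * G)%E).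
    apply: leeD => //; rewrite EFinM; apply: lee_wpmul2l => //.
    by rewrite lee_fin ltW.
  have mn (w : D12_0 Omega) :
      measurable_fun Omega (fun x => `|w x| : measurableTypeR R).
    by apply: measurableT_comp => //; exact: D12_measurable_fun.
  have mnt (w : D12_0 Omega) :
      measurable_fun Omega (fun x => `|w x| + t * k : measurableTypeR R).
    by apply: (measurable_funD (mn w)); exact: measurable_cst.
  have md : measurable_fun Omega (fun x => (density x `|u x| `|v x|)%:E).
    by apply/measurable_EFinP; apply: measurable_density; exact: mn.
  have mg :
      measurable_fun Omega (fun x => (gain s lambda mu x `|u x| `|v x|)%:E).
    by apply/measurable_EFinP; apply: measurable_gain; exact: mn.
  have d0 (x : 'rV[R]_N) (a b : R) : (0 <= (density x a b)%:E)%E.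
    by rewrite lee_fin; exact: (density_ge0 alpha beta N3 s2 l0 m0 k0).
  have gn0 (x : 'rV[R]_N) (a b : R) : (0 <= (gain s lambda mu x a b)%:E)%E.
    by rewrite lee_fin; exact: gain_ge0.
  rewrite /G /couplingE -ge0_integralZl//; last by rewrite lee_fin ltW.
  rewrite -ge0_integralD//; first last.
  - by apply: emeasurable_funM.
  - by move=> x _; rewrite mule_ge0// lee_fin ltW.
  apply: ge0_le_integral => //.
  - by move=> x _; rewrite adde_ge0// mule_ge0// lee_fin ltW.
  - by apply: emeasurable_funD => //; apply: emeasurable_funM.
  - by apply/measurable_EFinP; apply: measurable_density; exact: mnt.
  - move=> x _; rewrite -EFinM -EFinD lee_fin.
    by apply: density_gain => //; exact: ltW.
have CE : 0 <= coupling u v + t * (k * c).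
  by rewrite addr_ge0 ?(ltW C0)// !mulr_ge0 ?ltW.
rewrite -SE -/B -ler_pdivlMl// [Sinf^-1 * B]mulrC.
apply: (@le_trans _ _ (((B / Sinf) `^ (p / 2)) `^ (2 / p))).
  by apply: (ge0_ler_powR th0) hC; rewrite nnegrE ?powR_ge0.
by rewrite -powRrM th1 powRr1.
Qed.

End minimizer.

Theorem theorem10 (R : realType) (N : nat) (s lambda mu kappa alpha beta : R)
    (Omega : set 'rV[R]_N) :
  (3 <= N)%N -> 0 < s -> s < 2 -> 0 < lambda -> 0 < mu -> 0 < kappa ->
  1 < alpha -> 1 < beta -> alpha + beta = twostar N s ->
  open Omega -> bounded_set Omega -> connected Omega ->
  Omega 0 ->
  ~ S_attained Omega s lambda mu kappa alpha beta.
Proof.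
move=> N3 s0 s2 l0 m0 k0 a1 b1 ab oO bO _ O0.
exact: not_attained.
Qed.
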